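(* Let $N, A$ be finite-dimensional unital $\mathbb C$-algebras of dimension $n$. Suppose that there is a flat deformation from $N$ to $A$. Then there is a formal deformation of $N$ which is a flat deformation from $N$ to $A$ and which is obtained by the method described in the context (that is, it arises from some homomorphism $f$ satisfying assumptions (1)--(3)).
   Context: All algebras are associative and unital (usually noncommutative) and all algebra homomorphisms are unital. $\mathbb C\{t\}$ denotes the ring of formal power series in $t$ over $\mathbb C$ (no convergence assumed). $\mathbb C\langle x_1,\ldots,x_\rho\rangle\{t\}$ denotes the free unital associative $\mathbb C\{t\}$-algebra on $x_1,\ldots,x_\rho$ (finite $\mathbb C\{t\}$-linear combinations of words); it contains the free $\mathbb C$-algebra $\mathbb C\langle x_1,\ldots,x_\rho\rangle$ and the polynomial ring $\mathbb C\langle x_1,\ldots,x_\rho\rangle[t]$. For a finite-dimensional $\mathbb C$-algebra $A$, $A\{t\}$, $A((t))$ and $A[t,t^{-1}]$ denote respectively the power series, Laurent series and Laurent polynomials in the central variable $t$ with coefficients in $A$. A formal deformation of a $\mathbb C$-algebra $(N,\cdot,+)$ is an associative $\mathbb C\{t\}$-bilinear multiplication $\circ$ on the $\mathbb C\{t\}$-module $N\{t\}$ such that $(N\{t\},\circ,+)/t(N\{t\},\circ,+)\cong(N,\cdot,+)$ as a $\mathbb C$-algebra. A deformation of a unital $\mathbb C$-algebra $N$ over $\mathbb C\{t\}$ is a $\mathbb C\{t\}$-algebra $\mathcal N$ which is a free $\mathbb C\{t\}$-module and such that $\mathcal N/t\mathcal N$ is isomorphic to $N$; it is assumed that the image of the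 identity element of $N$ is the identity element of $\mathcal N$. A flat deformation from $N$ to a unital algebra $A$ (over $\mathbb C\{t\}$) is such a deformation $\mathcal N$ for which $\mathcal N\otimes_{\mathbb C\{t\}}\mathbb C\{\{t\}\}$ is isomorphic to $A\otimes_{\mathbb C}\mathbb C\{\{t\}\}$, where $\mathbb C\{\{t\}\}$ denotes the algebraic closure of the fraction field of $\mathbb C\{t\}$. The method: let $\rho$ be a natural number and $f:\mathbb C\langle x_1,\ldots,x_\rho\rangle\{t\}\to A((t))$ a unital homomorphism of $\mathbb C\{t\}$-algebras such that (1) $f(x_i)\in A[t,t^{-1}]$ for every $i$; (2) there are $c_1,\ldots,c_n\in\mathbb C\langle x_1,\ldots,x_\rho\rangle$ such that $f(c_1),\ldots,f(c_n)$ are linearly independent over $\mathbb C\{t\}$; (3) there is a natural number $\gamma$ with $\operatorname{Im}(f)\subseteq t^{-\gamma}A\{t\}$. For such $f$ there are $q_1,\ldots,q_n\in\mathbb C\langle x_1,\ldots,x_\rho\rangle[t]$ such that $f(q_1),\ldots,f(q_n)$ is a $\mathbb C\{t\}$-basis of $\operatorname{Im}(f)$; write $f(q_k)f(q_m)=\sum_{i=1}^n(\zeta_{i,k,m}+t\xi_{i,k,m}(t))f(q_i)$ with $\zeta_{i,k,m}\in\mathbb C$, $\xi_{i,k,m}(t)\in\mathbb C\{t\}$. The deformation obtained by the method from $f$ is the $\mathbb C\{t\}$-algebra $\mathcal N$ with $\mathbb C\{t\}$-basis $d_1,\ldots,d_n$ and multiplication $d_k\ast_t d_m=\sum_{i=1}^n(\zeta_{i,k,m}+t\xi_{i,k,m}(t))d_i$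 (so $\mathcal N\cong\operatorname{Im}(f)$). It is a deformation of the $\mathbb C$-algebra with basis $d_1,\ldots,d_n$ and multiplication $d_kd_m=\sum_{i=1}^n\zeta_{i,k,m}d_i$, which is isomorphic to $\operatorname{Im}(f)/t\cdot\operatorname{Im}(f)$. *)

(* Defs.v *)
From HB Require Import structures.
From mathcomp Require Import all_boot all_order all_algebra all_field.
From mathcomp Require Import boolp reals complex monalg zify.

Set Implicit Arguments.
Unset Strict Implicit.
Unset Printing Implicit Defensive.

Import Order.TTheory GRing.Theory Num.Theory.
Local Open Scope ring_scope.

(* pseries R is the ring R{t} of formal power series; pvar below is t, pconst
   the embedding of constants and pcoef_at0 the reduction modulo t. *)
Record pseries (R : Type) := PSeries { pcoef :> nat -> R }.

Lemma pseriesP (R : Type) (p q : pseries R) : (forall n, p n = q n) -> p = q.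
Proof. by case: p q => [p] [q] /= /funext ->. Qed.

HB.instance Definition _ (R : Type) := gen_eqMixin (pseries R).
HB.instance Definition _ (R : Type) := gen_choiceMixin (pseries R).

Section PSeriesZmod.
Variable V : zmodType.
Implicit Types p q : pseries V.

Definition pszero : pseries V := PSeries (fun=> 0).
Definition psopp p := PSeries (fun n => - p n).
Definition psadd p q := PSeries (fun n => p n + q n).

Fact psaddA : associative psadd.
Proof. by move=> p q r; apply: pseriesP => n /=; rewrite addrA. Qed.
Fact psaddC : commutative psadd.
Proof. by move=> p q; apply: pseriesP => n /=; rewrite addrC. Qed.
Fact psadd0 : left_id pszero psadd.
Proof. by move=> p; apply: pseriesP => n /=; rewrite add0r. Qed.
Fact psaddN : left_inverse pszero psopp psadd.
Proof. by move=> p; apply: pseriesP => n /=; rewrite addNr. Qed.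

HB.instance Definition _ :=
  GRing.isZmodule.Build (pseries V) psaddA psaddC psadd0 psaddN.

Lemma pcoef0 n : (0 : pseries V) n = 0. Proof. by []. Qed.
Lemma pcoefD p q n : (p + q) n = p n + q n. Proof. by []. Qed.
Lemma pcoefN p n : (- p) n = - p n. Proof. by []. Qed.

End PSeriesZmod.

Section PSeriesRing.
Variable R : nzRingType.
Implicit Types p q r : pseries R.

Definition pconst (c : R) : pseries R :=
  PSeries (fun n => if n == 0%N then c else 0).
Definition psmul p q : pseries R :=
  PSeries (fun n => \sum_(i < n.+1) p i * q (n - i)%N).

Let tr n p : {poly R} := \poly_(i < n) p i.

Let psmul_tr n k p q : (k < n)%N -> psmul p q k = (tr n p * tr n q)`_k.
Proof.
move=> kn; rewrite coefM /=; apply: eq_bigr => i _; rewrite !coef_poly.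
by rewrite (leq_ltn_trans _ kn) ?(leq_ltn_trans (leq_subr i k) kn) // -ltnS.
Qed.

Fact psmulA : associative psmul.
Proof.
move=> p q r; apply: pseriesP => n.
transitivity ((tr n.+1 p * (tr n.+1 q * tr n.+1 r))`_n).
  rewrite coefM; apply: eq_bigr => i _; rewrite coef_poly ltn_ord.
  by rewrite (@psmul_tr n.+1) // ltnS leq_subr.
rewrite mulrA coefM; apply: eq_bigr => i _.
by rewrite [in RHS](@psmul_tr n.+1) // [X in _ * X]coef_poly ltnS leq_subr.
Qed.

Fact psmul1p : left_id (pconst 1) psmul.
Proof.
move=> p; apply: pseriesP => n /=; rewrite big_ord_recl /= mul1r subn0.
by rewrite big1 ?addr0 // => i _; rewrite mul0r.
Qed.

Fact psmulp1 : right_id (pconst 1) psmul.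
Proof.
move=> p; apply: pseriesP => n /=; rewrite big_ord_recr /= subnn mulr1.
rewrite big1 ?add0r // => i _; rewrite subn_eq0 leqNgt ltn_ord /=.
by rewrite mulr0.
Qed.

Fact psmulDl : left_distributive psmul +%R.
Proof.
move=> p q r; apply: pseriesP => n /=; rewrite -big_split /=.
by apply: eq_bigr => i _; rewrite mulrDl.
Qed.

Fact psmulDr : right_distributive psmul +%R.
Proof.
move=> p q r; apply: pseriesP => n /=; rewrite -big_split /=.
by apply: eq_bigr => i _; rewrite mulrDr.
Qed.

Fact psone_neq0 : pconst 1 != 0.
Proof.
by apply/eqP => /(congr1 (fun p : pseries R => p 0%N)) /eqP; rewrite /= oner_eq0.
Qed.

HB.instance Definition _ := GRing.Zmodule_isNzRing.Build (pseries R)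
  psmulA psmul1p psmulp1 psmulDl psmulDr psone_neq0.

Lemma pcoef1 n : (1 : pseries R) n = if n == 0%N then 1 else 0.
Proof. by []. Qed.
Lemma pcoefM p q n : (p * q) n = \sum_(i < n.+1) p i * q (n - i)%N.
Proof. by []. Qed.

Fact pconst_is_additive : {morph pconst : x y / x - y}.
Proof. by move=> x y; apply: pseriesP => -[|n] //=; rewrite subr0. Qed.
Fact pconst_is_multiplicative : monoid_morphism pconst.
Proof.
split=> // x y; apply: pseriesP => n; rewrite pcoefM big_ord_recl /= subn0.
rewrite big1 ?addr0 => [|i _]; last by rewrite mul0r.
by case: n => //=; rewrite mulr0.
Qed.
HB.instance Definition _ :=
  GRing.isZmodMorphism.Build R (pseries R) pconst pconst_is_additive.
HB.instance Definition _ :=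
  GRing.isMonoidMorphism.Build R (pseries R) pconst pconst_is_multiplicative.

Definition pcoef_at0 (p : pseries R) : R := p 0%N.

Fact pcoef_at0_is_additive : {morph pcoef_at0 : x y / x - y}.
Proof. by []. Qed.
Fact pcoef_at0_is_multiplicative : monoid_morphism pcoef_at0.
Proof.
by split=> // x y; rewrite /pcoef_at0 pcoefM big_ord1 subnn.
Qed.
HB.instance Definition _ :=
  GRing.isZmodMorphism.Build (pseries R) R pcoef_at0 pcoef_at0_is_additive.
HB.instance Definition _ :=
  GRing.isMonoidMorphism.Build (pseries R) R pcoef_at0
    pcoef_at0_is_multiplicative.

Definition pvar : pseries R := PSeries (fun n => if n == 1%N then 1 else 0).

Lemma pcoef_varM p n : (pvar * p) n = if n is n'.+1 then p n' else 0.
Proof.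
rewrite pcoefM big_ord_recl /= mul0r add0r; case: n => [|n].
  by rewrite big_ord0.
rewrite big_ord_recl /= mul1r subn1 big1 ?addr0 // => i _.
by rewrite mul0r.
Qed.

Lemma pvar_comm p : GRing.comm pvar p.
Proof.
apply: pseriesP => -[|n]; rewrite pcoef_varM pcoefM.
  by rewrite big_ord1 mulr0.
rewrite big_ord_recr /= subnn mulr0 addr0 big_ord_recr /= subSnn mulr1.
rewrite big1 ?add0r // => i _.
by rewrite (subSn (ltnW (ltn_ord i))) eqSS subn_eq0 leqNgt ltn_ord mulr0.
Qed.

End PSeriesRing.
Arguments pvar {R}.

Section PSeriesCom.
Variable R : comNzRingType.
Fact psmulC : @commutative (pseries R) _ *%R.
Proof.
move=> p q; apply: pseriesP => n; rewrite !pcoefM (reindex_inj rev_ord_inj) /=.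
by apply: eq_bigr => i _; rewrite subSS subKn 1?mulrC // -ltnS.
Qed.
HB.instance Definition _ :=
  GRing.PzRing_hasCommutativeMul.Build (pseries R) psmulC.
End PSeriesCom.

Section PSeriesIdomain.
Variable R : idomainType.
Implicit Types p q : pseries R.

Definition psunit : {pred pseries R} := fun p => `[< exists q, q * p = 1 >].
Definition psinv p : pseries R :=
  if pselect (exists q, q * p = 1) is left ex then projT1 (cid ex) else p.

Fact psmulV : {in psunit, left_inverse 1 psinv *%R}.
Proof.
move=> p /asboolP pu; rewrite /psinv; case: pselect => // ex.
exact: (projT2 (cid ex)).
Qed.
Fact psunitP p q : q * p = 1 -> psunit p.
Proof. by move=> qp; apply/asboolP; exists q. Qed.
Fact psinv_out : {in [predC psunit], psinv =1 id}.
Proof.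
by move=> p /asboolP pu; rewrite /psinv; case: pselect.
Qed.
HB.instance Definition _ :=
  GRing.ComNzRing_hasMulInverse.Build (pseries R) psmulV psunitP psinv_out.

Let lowest p : p <> 0 -> exists2 m, p m != 0 & forall i, (i < m)%N -> p i = 0.
Proof.
move=> p0; have ex : exists n, p n != 0.
  apply: contrapT => no; apply: p0; apply: pseriesP => n.
  by apply/eqP; apply: contrapT => /negP pn; apply: no; exists n.
exists (ex_minn ex); first by case: ex_minnP.
case: ex_minnP => m _ min i im; apply/eqP; apply: contraLR im.
by rewrite -leqNgt; apply: min.
Qed.

Fact psmul_eq0 p q : p * q = 0 -> (p == 0) || (q == 0).
Proof.
move=> pq0; apply/orP; apply: contrapT => /not_orP[/negP/eqP p0 /negP/eqP q0].
have [m pm pl] := lowest p0; have [k qk ql] := lowest q0.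
have mk : (m < (m + k).+1)%N by rewrite ltnS leq_addr.
have := congr1 (fun r : pseries R => r (m + k)%N) pq0.
rewrite pcoefM (bigD1 (Ordinal mk)) //= addKn big1 ?addr0 => [|i].
  by move/eqP; rewrite mulf_eq0 (negbTE pm) (negbTE qk).
rewrite -val_eqE /= neq_ltn => /orP[/pl->|mi]; first by rewrite mul0r.
suff -> : q (m + k - i)%N = 0 by rewrite mulr0.
by apply: ql; have := ltn_ord i; lia.
Qed.
HB.instance Definition _ :=
  GRing.ComUnitRing_isIntegral.Build (pseries R) psmul_eq0.
End PSeriesIdomain.

Section PSeriesModule.
Variables (F : comNzRingType) (A : algType F).
Implicit Types (a b : pseries F) (p q : pseries A).

Definition plift a : pseries A := PSeries (fun n => (a n)%:A).

Fact plift_is_additive : {morph plift : x y / x - y}.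
Proof. by move=> x y; apply: pseriesP => n /=; rewrite scalerBl. Qed.
Fact plift_is_multiplicative : monoid_morphism plift.
Proof.
split; first by apply: pseriesP => -[|n] /=; rewrite ?scale1r ?scale0r.
move=> x y; apply: pseriesP => n; rewrite /= scaler_suml.
by apply: eq_bigr => i _; rewrite -scalerAl mul1r scalerA.
Qed.
HB.instance Definition _ :=
  GRing.isZmodMorphism.Build (pseries F) (pseries A) plift plift_is_additive.
HB.instance Definition _ :=
  GRing.isMonoidMorphism.Build (pseries F) (pseries A) plift
    plift_is_multiplicative.

Lemma plift_comm a p : plift a * p = p * plift a.
Proof.
apply: pseriesP => n; rewrite !pcoefM (reindex_inj rev_ord_inj) /=.
apply: eq_bigr => i _; rewrite subSS subKn; last by rewrite -ltnS.
by rewrite -scalerAl mul1r -scalerAr mulr1.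
Qed.

Definition psscale a p : pseries A :=
  PSeries (fun n => \sum_(i < n.+1) a i *: p (n - i)%N).

Lemma psscaleE a p : psscale a p = plift a * p.
Proof.
apply: pseriesP => n; rewrite pcoefM; apply: eq_bigr => i _ /=.
by rewrite -scalerAl mul1r.
Qed.

Fact psscaleA a b p : psscale a (psscale b p) = psscale (a * b) p.
Proof. by rewrite !psscaleE rmorphM mulrA. Qed.
Fact psscale1 : left_id 1 psscale.
Proof. by move=> p; rewrite psscaleE rmorph1 mul1r. Qed.
Fact psscaleDr : right_distributive psscale +%R.
Proof. by move=> a p q; rewrite !psscaleE mulrDr. Qed.
Fact psscaleDl p : {morph psscale^~ p : a b / a + b}.
Proof. by move=> a b; rewrite !psscaleE rmorphD mulrDl. Qed.
HB.instance Definition _ := GRing.Zmodule_isLmodule.Build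
  (pseries F) (pseries A) psscaleA psscale1 psscaleDr psscaleDl.

Lemma pcoefZ a p n : (a *: p) n = \sum_(i < n.+1) a i *: p (n - i)%N.
Proof. by []. Qed.
Lemma pscaleE a p : a *: p = plift a * p.
Proof. exact: psscaleE. Qed.

End PSeriesModule.

(* laurent A is A((t)). *)
Record laurent (A : zmodType) := Laurent {
  lcoef :> int -> A;
  lcoef_bounded : exists m : nat, forall k : int, k < - m%:Z -> lcoef k = 0
}.

Lemma laurentP (A : zmodType) (f g : laurent A) :
  (forall k, f k = g k) -> f = g.
Proof.
case: f g => [f fb] [g gb] /= /funext fg; case: _ / fg gb => gb.
by congr Laurent; apply: Prop_irrelevance.
Qed.

HB.instance Definition _ (A : zmodType) := gen_eqMixin (laurent A).
HB.instance Definition _ (A : zmodType) := gen_choiceMixin (laurent A).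

Section LaurentZmod.
Variable A : zmodType.
Implicit Types (f g : laurent A) (p q : pseries A).

Definition lmake_coef (m : nat) p (k : int) : A :=
  if k + m%:Z is Posz n then p n else 0.
Fact lmake_bounded m p :
  exists d : nat, forall k : int, k < - d%:Z -> lmake_coef m p k = 0.
Proof.
exists m => k; rewrite /lmake_coef -subr_lt0 opprK.
by case: (k + m%:Z).
Qed.
(* lmake m p is t^(-m) p. *)
Definition lmake m p : laurent A := Laurent (lmake_bounded m p).

Definition lpole f : nat := projT1 (cid (lcoef_bounded f)).
Definition lnum f : pseries A := PSeries (fun n => f (n%:Z - (lpole f)%:Z)).

Lemma lmakeK f : lmake (lpole f) (lnum f) = f.
Proof.
apply: laurentP => k; rewrite /= /lmake_coef.
case E : (k + (lpole f)%:Z) => [n|n] /=; first by rewrite -E addrK.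
rewrite (projT2 (cid (lcoef_bounded f))) // -subr_lt0 opprK -/(lpole f).
by rewrite E.
Qed.

Lemma lmake_inj m : injective (lmake m).
Proof.
move=> p q pq; apply: pseriesP => n.
have := congr1 (fun f : laurent A => f (n%:Z - m%:Z)) pq.
by rewrite /= /lmake_coef subrK.
Qed.

Fact lopp_bounded f :
  exists d : nat, forall k : int, k < - d%:Z -> - f k = 0.
Proof.
by have [m fm] := lcoef_bounded f; exists m => k /fm->; rewrite oppr0.
Qed.
Fact ladd_bounded f g :
  exists d : nat, forall k : int, k < - d%:Z -> f k + g k = 0.
Proof.
have [m fm] := lcoef_bounded f; have [d gd] := lcoef_bounded g.
exists (m + d)%N => k kl; rewrite fm ?gd ?addr0 //; apply: (lt_le_trans kl);
  by rewrite lerN2 lez_nat ?leq_addl ?leq_addr.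
Qed.

Definition lopp f : laurent A := Laurent (lopp_bounded f).
Definition ladd f g : laurent A := Laurent (ladd_bounded f g).

Fact laddA : associative ladd.
Proof. by move=> p q r; apply: laurentP => n /=; rewrite addrA. Qed.
Fact laddC : commutative ladd.
Proof. by move=> p q; apply: laurentP => n /=; rewrite addrC. Qed.
Fact ladd0 : left_id (lmake 0 0) ladd.
Proof.
move=> p; apply: laurentP => n; rewrite /= /lmake_coef.
by case: (n + _) => ?; rewrite add0r.
Qed.
Fact laddN : left_inverse (lmake 0 0) lopp ladd.
Proof.
move=> p; apply: laurentP => n; rewrite /= /lmake_coef addNr.
by case: (n + _).
Qed.
HB.instance Definition _ :=
  GRing.isZmodule.Build (laurent A) laddA laddC ladd0 laddN.

Lemma lcoef0 k : (0 : laurent A) k = 0.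
Proof. by rewrite /= /lmake_coef; case: (k + _). Qed.
Lemma lcoefD f g k : (f + g) k = f k + g k. Proof. by []. Qed.
Lemma lcoefN f k : (- f) k = - f k. Proof. by []. Qed.

Lemma lmakeD m : {morph lmake m : p q / p + q}.
Proof.
move=> p q; apply: laurentP => k; rewrite /= /lmake_coef.
by case: (k + _) => // _; rewrite addr0.
Qed.

End LaurentZmod.

Section LaurentRing.
Variable A : nzRingType.
Implicit Types (f g h : laurent A) (p q : pseries A).

Lemma lmake_var m k p : lmake (k + m) (pvar ^+ k * p) = lmake m p.
Proof.
elim: k p => [|k IH] p; first by rewrite mul1r.
rewrite exprS -mulrA -[RHS]IH; apply: laurentP => j; rewrite /= /lmake_coef.
rewrite addSn -addn1 PoszD addrA; move: (pvar ^+ k * p) => q.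
case: (j + _) => [n|[|n]].
- have -> : Posz n + 1 = n.+1 by lia.
  by rewrite pcoef_varM.
- have -> : Negz 0 + 1 = Posz 0 by [].  
  by rewrite pcoef_varM.
- by have -> : Negz n.+1 + 1 = Negz n by lia.
Qed.

(* Convolution, written as (t^(-m) p) (t^(-d) q) = t^(-(m + d)) (p q); the
   lemma lmakeM shows that the choice of the orders m and d is irrelevant. *)
Definition lmul f g : laurent A := lmake (lpole f + lpole g) (lnum f * lnum g).

Lemma lmake_mul_wd m m1 d d1 p p1 q q1 :
  lmake m p = lmake m1 p1 -> lmake d q = lmake d1 q1 ->
  lmake (m + d) (p * q) = lmake (m1 + d1) (p1 * q1).
Proof.
move=> pp qq.
have {}pp : pvar ^+ m1 * p = pvar ^+ m * p1.
  by apply: (@lmake_inj _ (m + m1)); rewrite {1}addnC !lmake_var.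
have {}qq : pvar ^+ d1 * q = pvar ^+ d * q1.
  by apply: (@lmake_inj _ (d + d1)); rewrite {1}addnC !lmake_var.
have cv k r : pvar ^+ k * r = r * pvar ^+ k.
  by apply/commr_sym/commrX/commr_sym/pvar_comm.
rewrite -(lmake_var (m + d) (m1 + d1)) -(lmake_var (m1 + d1) (m + d)).
rewrite [in RHS]addnC; congr lmake.
have E a b u v : pvar ^+ (a + b) * (u * v) = (pvar ^+ a * u) * (pvar ^+ b * v).
  by rewrite exprD -2!mulrA; congr (_ * _); rewrite !mulrA cv.
by rewrite !E pp qq.
Qed.

Lemma lmakeM m d p q :
  lmul (lmake m p) (lmake d q) = lmake (m + d) (p * q).
Proof. by apply: lmake_mul_wd; rewrite lmakeK. Qed.

Lemma lmake_surj f : exists m p, f = lmake m p.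
Proof. by exists (lpole f), (lnum f); rewrite lmakeK. Qed.

Lemma lmake_surj2 f g : exists m p q, f = lmake m p /\ g = lmake m q.
Proof.
exists (lpole g + lpole f)%N.
exists (pvar ^+ lpole g * lnum f), (pvar ^+ lpole f * lnum g).
by rewrite lmake_var addnC lmake_var !lmakeK.
Qed.

Fact lmulA : associative lmul.
Proof.
move=> f g h; have [m [p ->]] := lmake_surj f; have [d [q ->]] := lmake_surj g.
by have [e [r ->]] := lmake_surj h; rewrite !lmakeM addnA mulrA.
Qed.
Fact lmul1l : left_id (lmake 0 1) lmul.
Proof. by move=> f; have [m [p ->]] := lmake_surj f; rewrite lmakeM mul1r. Qed.
Fact lmul1r : right_id (lmake 0 1) lmul.
Proof.
by move=> f; have [m [p ->]] := lmake_surj f; rewrite lmakeM mulr1 addn0.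
Qed.
Fact lmulDl : left_distributive lmul +%R.
Proof.
move=> f g h; have [m [p [q [-> ->]]]] := lmake_surj2 f g.
by have [e [r ->]] := lmake_surj h; rewrite -lmakeD !lmakeM mulrDl lmakeD.
Qed.
Fact lmulDr : right_distributive lmul +%R.
Proof.
move=> h f g; have [m [p [q [-> ->]]]] := lmake_surj2 f g.
by have [e [r ->]] := lmake_surj h; rewrite -lmakeD !lmakeM mulrDr lmakeD.
Qed.
Fact lone_neq0 : lmake 0 1 != 0 :> laurent A.
Proof. by apply/eqP => /lmake_inj /eqP; rewrite oner_eq0. Qed.
HB.instance Definition _ := GRing.Zmodule_isNzRing.Build (laurent A)
  lmulA lmul1l lmul1r lmulDl lmulDr lone_neq0.

End LaurentRing.

Section LaurentAlgebra.
Variables (F : comNzRingType) (A : algType F).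
Implicit Types (a b : pseries F) (f g : laurent A).

Definition lscale a f : laurent A := lmake (lpole f) (a *: lnum f).

Lemma lmakeZ a m (p : pseries A) : lscale a (lmake m p) = lmake m (a *: p).
Proof.
rewrite /lscale !pscaleE -[lpole _]add0n -[X in _ = lmake X _]add0n.
by apply: lmake_mul_wd; rewrite ?lmakeK.
Qed.

Fact lscaleA a b f : lscale a (lscale b f) = lscale (a * b) f.
have [m [p ->]] := lmake_surj f.
by rewrite [RHS]lmakeZ [lscale b _]lmakeZ [LHS]lmakeZ scalerA.
Qed.
Fact lscale1 : left_id 1 lscale.
Proof. by move=> f; have [m [p ->]] := lmake_surj f; rewrite lmakeZ scale1r. Qed.
Fact lscaleDr : right_distributive lscale +%R.
Proof.
move=> a f g; have [m [p [q [-> ->]]]] := lmake_surj2 f g.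
by rewrite -lmakeD !lmakeZ scalerDr lmakeD.
Qed.
Fact lscaleDl f : {morph lscale^~ f : a b / a + b}.
Proof.
move=> a b; have [m [p ->]] := lmake_surj f.
by rewrite !lmakeZ scalerDl lmakeD.
Qed.
HB.instance Definition _ := GRing.Zmodule_isLmodule.Build
  (pseries F) (laurent A) lscaleA lscale1 lscaleDr lscaleDl.

Fact lscaleAl a f g : a *: (f * g) = (a *: f) * g.
Proof.
have [m [p ->]] := lmake_surj f; have [d [q ->]] := lmake_surj g.
rewrite [lmake m p * _]lmakeM [LHS]lmakeZ [a *: lmake m p]lmakeZ.
by rewrite [RHS]lmakeM !pscaleE mulrA.
Qed.
Fact lscaleAr a f g : a *: (f * g) = f * (a *: g).
Proof.
have [m [p ->]] := lmake_surj f; have [d [q ->]] := lmake_surj g.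
rewrite [lmake m p * _]lmakeM [LHS]lmakeZ [a *: lmake d q]lmakeZ.
by rewrite [RHS]lmakeM !pscaleE mulrA plift_comm -!mulrA plift_comm.
Qed.
HB.instance Definition _ :=
  GRing.Lmodule_isLalgebra.Build (pseries F) (laurent A) lscaleAl.
HB.instance Definition _ :=
  GRing.Lalgebra_isAlgebra.Build (pseries F) (laurent A) lscaleAr.

End LaurentAlgebra.

Section LinearFamilies.
Variables (S : nzRingType) (M : lmodType S) (n : nat).
Implicit Types v : 'I_n -> M.

Definition lin_indep v : Prop :=
  forall a : 'I_n -> S, \sum_i a i *: v i = 0 -> forall i, a i = 0.

Definition is_basis_of (X : M -> Prop) v : Prop :=
  [/\ forall i, X (v i), lin_indep v
    & forall x, X x -> exists a : 'I_n -> S, x = \sum_i a i *: v i].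

End LinearFamilies.

(* {malg S[I]} is the free S-module on I. *)
Definition free_module (S : nzRingType) (M : lmodType S) : Prop :=
  exists (I : choiceType) (h : {linear {malg S[I]} -> M}), bijective h.

Section BaseChange.
Variables (S : comNzRingType) (K : fieldType) (phi : {rmorphism S -> K}).

(* P, with j : x |-> x (x) 1, is the extension of scalars of M along phi: the
   universal property of the tensor product of M and K over S. *)
Definition is_base_change (M : lmodType S) (P : lmodType K)
    (j : {linear M -> P | phi \; *:%R}) : Prop :=
  forall (Q : lmodType K) (g : {linear M -> Q | phi \; *:%R}),
  exists h : {linear P -> Q},
    (forall x, h (j x) = g x) /\
    forall h' : {linear P -> Q}, (forall x, h' (j x) = g x) -> h' =1 h.

(* Since j is multiplicative and P is a K-algebra, the product of P is
   (x (x) a) (y (x) b) = xy (x) ab. *)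
Definition is_alg_base_change (M : algType S) (P : algType K)
    (j : {lrmorphism M -> P | phi \; *:%R}) : Prop :=
  is_base_change j.

End BaseChange.

Definition is_algebraic_closure (E : fieldType) (K : closedFieldType)
    (iota : {rmorphism E -> K}) : Prop :=
  forall x : K, algebraicOver iota x.

Section Deformations.
Variable F : fieldType.

(* DD / t DD is isomorphic to N as a unital F-algebra: pi is the quotient map
   followed by the isomorphism. *)
Definition reduces_to (DD : algType (pseries F)) (N : algType F) : Prop :=
  exists pi : {lrmorphism DD -> N | @pcoef_at0 F \; *:%R},
    (forall y, exists x, pi x = y) /\
    (forall x, pi x = 0 <-> exists x', x = pvar *: x').

Definition is_deformation (N : algType F) (DD : algType (pseries F)) : Prop :=
  free_module DD /\ reduces_to DD N.

Variables (K : closedFieldType) (iota : {rmorphism {fraction pseries F} -> K}).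

Definition is_flat_deformation (N A : algType F) (DD : algType (pseries F)) :
    Prop :=
  is_deformation N DD /\
  exists (P1 P2 : algType K)
         (j1 : {lrmorphism DD -> P1 | (iota \o @tofrac (pseries F)) \; *:%R})
         (j2 : {lrmorphism A -> P2
                 | (iota \o @tofrac (pseries F) \o @pconst F) \; *:%R}),
    [/\ is_alg_base_change j1, is_alg_base_change j2
      & exists h : {lrmorphism P1 -> P2}, bijective h].

End Deformations.

(* The unit is required to be the image 1_N of the unit of N in N{t}. *)
Record formal_mul (F : comNzRingType) (N : algType F) := FormalMul {
  fmul : pseries N -> pseries N -> pseries N;
  fmulA : associative fmul;
  fmul1l : left_id (pconst 1) fmul;
  fmul1r : right_id (pconst 1) fmul;
  fmulDl : left_distributive fmul +%R;
  fmulDr : right_distributive fmul +%R;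
  fmulZl : forall (a : pseries F) x y, fmul (a *: x) y = a *: fmul x y;
  fmulZr : forall (a : pseries F) x y, fmul x (a *: y) = a *: fmul x y
}.

(* The module N{t} equipped with the multiplication m. *)
Definition deformed (F : comNzRingType) (N : algType F) (m : formal_mul N) :
  Type := pseries N.

Section Deformed.
Variables (F : comNzRingType) (N : algType F) (m : formal_mul N).

HB.instance Definition _ := GRing.Lmodule.copy (deformed m) (pseries N).
HB.instance Definition _ := GRing.Zmodule_isNzRing.Build (deformed m)
  (fmulA m) (fmul1l m) (fmul1r m) (fmulDl m) (fmulDr m) (psone_neq0 N).
Fact deformed_scaleAl (a : pseries F) (x y : deformed m) :
  a *: (x * y) = (a *: x) * y.
Proof. by rewrite [RHS]fmulZl. Qed.
Fact deformed_scaleAr (a : pseries F) (x y : deformed m) :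
  a *: (x * y) = x * (a *: y).
Proof. by rewrite [RHS]fmulZr. Qed.
HB.instance Definition _ :=
  GRing.Lmodule_isLalgebra.Build (pseries F) (deformed m) deformed_scaleAl.
HB.instance Definition _ :=
  GRing.Lalgebra_isAlgebra.Build (pseries F) (deformed m) deformed_scaleAr.
End Deformed.

Definition is_formal_deformation (F : fieldType) (N : algType F)
    (m : formal_mul N) : Prop :=
  reduces_to (deformed m) N.

Notation free_alg F rho := {malg (pseries F)[{fmonom 'I_rho}]}.

Section Method.
Variable F : fieldType.

Definition free_gen (rho : nat) (i : 'I_rho) : free_alg F rho := << fmu i >>.

(* Membership in F<x_1, ..., x_rho> and in F<x_1, ..., x_rho>[t]. *)
Definition const_coefs (rho : nat) (p : free_alg F rho) : Prop :=
  forall w, exists c : F, p@_w = pconst c.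
Definition poly_coefs (rho : nat) (p : free_alg F rho) : Prop :=
  forall w, exists s : {poly F}, forall k, (p@_w) k = s`_k.

Variable A : algType F.

Definition laurent_poly (g : laurent A) : Prop :=
  exists m : nat, forall k : int, m%:Z < k -> g k = 0.
(* Membership in t^(-gamma) A{t}. *)
Definition pole_le (gamma : nat) (g : laurent A) : Prop :=
  forall k : int, k < - gamma%:Z -> g k = 0.

Definition method_assumptions (n rho : nat)
    (f : {lrmorphism free_alg F rho -> laurent A}) : Prop :=
  [/\ forall i : 'I_rho, laurent_poly (f (free_gen i)),
      exists c : 'I_n -> free_alg F rho,
        (forall i, const_coefs (c i)) /\ lin_indep (fun i => f (c i))
    & exists gamma : nat, forall p, pole_le gamma (f p)].

Definition obtained_by_method (n : nat) (DD : algType (pseries F)) : Prop :=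
  exists (rho : nat) (f : {lrmorphism free_alg F rho -> laurent A}),
    method_assumptions n f /\
    exists (q : 'I_n -> free_alg F rho) (zeta : 'I_n -> 'I_n -> 'I_n -> F)
           (xi : 'I_n -> 'I_n -> 'I_n -> pseries F) (d : 'I_n -> DD),
    [/\ forall i, poly_coefs (q i),
        is_basis_of (fun g => exists p, f p = g) (fun i => f (q i)),
        forall k m, f (q k) * f (q m) =
          \sum_i (pconst (zeta i k m) + pvar * xi i k m) *: f (q i),
        is_basis_of (fun _ => True) d
      & forall k m, d k * d m =
          \sum_i (pconst (zeta i k m) + pvar * xi i k m) *: d i].

End Method.

(* Main.v *)
From HB Require Import structures.
Require Import Defs.
From mathcomp Require Import all_boot all_order all_algebra all_field.
From mathcomp Require Import reals complex.
From mathcomp Require Import boolp monalg zify ring.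

(** Let DD be a flat deformation from N to A. Over the algebraic closure K of the
    Laurent series field C((t)), the algebras DD and A become isomorphic. In
    bases, the isomorphism is an invertible matrix G over K that satisfies
    polynomial equations with coefficients in C((t)). By Puiseux's theorem, K is
    the union of the fields C((t^(1/m))), so that G has entries in one of them;
    after the substitution t := t^m the isomorphism is defined over C((t)). This
    replaces DD by another deformation of N, because the substitution does not
    change the reduction modulo t, and this deformation is now a C{t}-subalgebra
    of A((t)), free of rank n over C{t}.

    Such a subalgebra L is obtained by the method. It has bounded poles, being
    finitely generated, and it contains t^e A{t} for large e, being of full rank.
    Hence cutting off the terms of high order of a basis of L changes it by
    elements of t L only, and by Nakayama's lemma the truncated elements, which
    are Laurent polynomials, still form a basis of L. The morphism f that takes
    the variables x_1, ..., x_n to these elements has image L.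

    Instead of embedding K in the Puiseux series, [puiseux_specialization] writes
    the entries of G as polynomials in one algebraic element z (primitive element
    theorem) and moves z to a root of its minimal polynomial in C((t^(1/m))),
    which exists by [puiseux_root]; this keeps all polynomial relations, and
    [structure_transfer] draws the consequence for G. [puiseux_root] rests on
    Hensel's lemma for factorizations, on the elimination of the subleading
    coefficient and on the Newton polygon.

    On the side of modules, [lift_basis] shows that a lift of a basis of N is a
    basis of DD, and [base_change_basis] and [basis_base_change] translate the
    universal property of the extension of scalars into the statement that a
    basis goes to a basis. With structure constants at hand,
    [transported_multiplication] defines the deformation on N{t}, and
    [realized_by_method] carries out the truncation argument. *)

Set Implicit Arguments.
Unset Strict Implicit.
Unset Printing Implicit Defensive.

Import Order.TTheory GRing.Theory Num.Theory.
Local Open Scope ring_scope.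

(** * Formal power series *)

(** Sequences are built below one term at a time, each term being constrained by
    the earlier ones only; the first hypothesis says that the constraint [Q n]
    does not look at the terms of index at least [n]. *)
Lemma strong_rec_choice (T : Type) (d : T) (Q : nat -> (nat -> T) -> T -> Prop) :
  (forall n f g x, (forall k, (k < n)%N -> f k = g k) -> Q n f x -> Q n g x) ->
  (forall n f, (forall k, (k < n)%N -> Q k f (f k)) -> exists x, Q n f x) ->
  exists f, forall n, Q n f (f n).
Proof.
move=> Qloc Qex.
have /choice[step stepP] (nf : nat * (nat -> T)) : exists x,
    (forall k, (k < nf.1)%N -> Q k nf.2 (nf.2 k)) -> Q nf.1 nf.2 x.
  case: (pselect (forall k, (k < nf.1)%N -> Q k nf.2 (nf.2 k))) => [H|nH].
    by have [x Qx] := Qex _ _ H; exists x.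
  by exists d => /nH.
pose fix G n : nat -> T :=
  if n is n'.+1 then fun k => if k == n' then step (n', G n') else G n' k
  else fun=> d.
pose f n := G n.+1 n.
have Gf n k : (k < n)%N -> G n k = f k.
  elim: n => // n IH; rewrite ltnS leq_eqVlt => /orP[/eqP->//|kn].
  by rewrite /= (ltn_eqF kn) IH.
exists f; elim/ltn_ind => n IH.
apply: (Qloc n (G n)); first by move=> k; apply: Gf.
rewrite /f /= eqxx; apply: (stepP (n, G n)) => k /= kn.
rewrite Gf //; apply: (Qloc k f) => [i ik|]; last exact: IH.
by rewrite Gf // (ltn_trans ik).
Qed.

Lemma pcoef_sum (V : zmodType) (I : Type) (r : seq I) (f : I -> pseries V) k :
  (\sum_(i <- r) f i) k = \sum_(i <- r) f i k.
Proof. by elim/big_rec2: _ => // i y x _ <-. Qed.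

Definition pshift (V : zmodType) k (p : pseries V) : pseries V :=
  PSeries (fun n => p (n + k)%N).

Section SeriesShift.
Variable R : nzRingType.
Implicit Types p q : pseries R.

Lemma pcoef_varXM k p n :
  (pvar ^+ k * p) n = if (k <= n)%N then p (n - k)%N else 0.
Proof.
elim: k n p => [|k IH] n p; first by rewrite mul1r subn0.
rewrite exprSr -mulrA IH pcoef_varM.
have [nk|kn|->] := ltngtP n k; rewrite ?subnn //.
by rewrite -(subnSK kn).
Qed.

Lemma pshiftK k p : (forall n, (n < k)%N -> p n = 0) -> pvar ^+ k * pshift k p = p.
Proof.
move=> p0; apply: pseriesP => n; rewrite pcoef_varXM /=.
by case: leqP => [/subnK->|/p0].
Qed.

Lemma pseries_head p : p = pconst (p 0%N) + pvar * pshift 1 p.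
Proof.
apply: pseriesP => -[|n]; rewrite pcoefD pcoef_varM /= ?addr0 //.
by rewrite addn1 add0r.
Qed.

Lemma pvar_neq0 : pvar != 0 :> pseries R.
Proof.
apply/eqP => /(congr1 (fun p : pseries R => p 1%N)) /eqP.
by rewrite /= oner_eq0.
Qed.

End SeriesShift.

Section SeriesField.
Variable F : fieldType.
Implicit Types p q : pseries F.

(** The coefficients of the inverse are determined one after the other, because
    the constant term of [p] can be divided by. *)
Lemma pseries_unit p : p 0%N != 0 -> p \is a GRing.unit.
Proof.
move=> p0.
have [] := @strong_rec_choice F 0 (fun n f x =>
    x * p 0%N = (n == 0%N)%:R - \sum_(i < n) f i * p (n - i)%N).
- move=> n f g x fg ->; congr (_ - _).
  by apply: eq_bigr => i _; rewrite fg.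
- move=> n f _; exists (((n == 0%N)%:R - \sum_(i < n) f i * p (n - i)%N) / p 0%N).
  by rewrite divfK.
move=> q qP; apply/unitrPr; exists (PSeries q); rewrite mulrC.
apply: pseriesP => n; rewrite pcoefM big_ord_recr /= subnn qP addrC subrK.
by case: n {qP}.
Qed.

Lemma pseries_valuation p :
  p != 0 -> exists v u, u \is a GRing.unit /\ p = pvar ^+ v * u.
Proof.
move=> /eqP p0; have ex : exists n, p n != 0.
  apply: contrapT => no; apply: p0; apply: pseriesP => n.
  by apply/eqP; apply: contrapT => /negP pn; apply: no; exists n.
exists (ex_minn ex), (pshift (ex_minn ex) p); case: ex_minnP => v pv vmin.
split; first by apply: pseries_unit.
rewrite pshiftK // => n; apply: contraTeq => pn.
by rewrite -leqNgt; apply: vmin.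
Qed.

End SeriesField.

Section Truncation.
Variable F : comNzRingType.
Implicit Types p q : pseries F.

Definition ptrunc k p : {poly F} := \poly_(i < k) p i.
Definition pofpoly (s : {poly F}) : pseries F := PSeries (fun n => s`_n).

Lemma pofpolyM s r : pofpoly (s * r) = pofpoly s * pofpoly r.
Proof. by apply: pseriesP => n /=; rewrite coefM. Qed.

(** Only finitely many coefficients enter a coefficient of a product, so that
    identities between series can be checked on polynomial truncations. *)
Lemma pcoefM_loc n p q p' q' : (forall i, (i <= n)%N -> p i = p' i) ->
  (forall i, (i <= n)%N -> q i = q' i) -> (p * q) n = (p' * q') n.
Proof.
move=> pp qq; rewrite !pcoefM; apply: eq_bigr => i _.
by rewrite pp ?qq ?leq_subr // -ltnS.
Qed.

End Truncation.

(** * The substitution of a power of t for t *)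

Section Substitution.
Variable F : comNzRingType.
Implicit Types p q : pseries F.

(** This is p(t^m). Extracting an m-th root of t amounts to viewing a series p
    as [psubst m p]: the field of series in t^(1/m) is a copy of the field of
    series in t, included in it by this substitution. *)
Definition psubst m p : pseries F :=
  PSeries (fun n => if (m %| n)%N then p (n %/ m)%N else 0).

Fact psubst_is_zmod_morphism m : zmod_morphism (psubst m).
Proof.
by move=> p q; apply: pseriesP => n /=; case: ifP; rewrite ?subr0.
Qed.

Lemma psubst0 p : psubst 0 p = pconst (p 0%N).
Proof. by apply: pseriesP => n /=; rewrite dvd0n divn0. Qed.

Lemma psubst_trunc m n k p : (0 < m)%N -> (n < k)%N ->
  psubst m p n = (ptrunc k p \Po 'X^m)`_n.
Proof.
move=> m0 nk; rewrite /= coef_comp_poly_Xn //; case: ifP => // _.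
by rewrite coef_poly (leq_ltn_trans (leq_div _ _)).
Qed.

(** For positive [m] the coefficients of p(t^m) are those of the composition of
    a truncation of [p] with the m-th power of the variable, and composition of
    polynomials is multiplicative. For [m = 0] the map is the evaluation at 0. *)
Fact psubst_is_monoid_morphism m : monoid_morphism (psubst m).
Proof.
case: (posnP m) => [->|m0].
  split=> [|p q]; first by rewrite psubst0.
  rewrite !psubst0 -rmorphM; congr pconst.
  by rewrite pcoefM big_ord1 subnn.
split=> [|p q]; apply: pseriesP => n.
  case: n => [|n] /=; first by rewrite dvdn0 div0n.
  by case: ifP => // mn; rewrite -leqn0 leqNgt divn_gt0 // (dvdn_leq _ mn).
rewrite (@pcoefM_loc _ n (psubst m p) (psubst m q)
  (pofpoly (ptrunc n.+1 p \Po 'X^m)) (pofpoly (ptrunc n.+1 q \Po 'X^m))).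
- rewrite -pofpolyM -comp_polyM /= coef_comp_poly_Xn //; case: ifP => // _.
  rewrite -[RHS]/(pofpoly (ptrunc n.+1 p * ptrunc n.+1 q) (n %/ m)%N) pofpolyM.
  by apply: pcoefM_loc => i im /=;
    rewrite coef_poly ltnS (leq_trans im) //; exact: leq_div.
- by move=> i im; apply: psubst_trunc.
- by move=> i im; apply: psubst_trunc.
Qed.

HB.instance Definition _ m := GRing.isZmodMorphism.Build
  (pseries F) (pseries F) (psubst m) (psubst_is_zmod_morphism m).
HB.instance Definition _ m := GRing.isMonoidMorphism.Build
  (pseries F) (pseries F) (psubst m) (psubst_is_monoid_morphism m).

Lemma psubst_inj m : (0 < m)%N -> injective (psubst m).
Proof.
move=> m0 p q pq; apply: pseriesP => n.
have := congr1 (fun r : pseries F => r (n * m)%N) pq.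
by rewrite /= dvdn_mull // mulnK.
Qed.

Lemma psubst_const m c : (0 < m)%N -> psubst m (pconst c) = pconst c.
Proof.
move=> m0; apply: pseriesP => -[|n] /=; first by rewrite dvdn0 div0n.
by case: ifP => // mn; rewrite -leqn0 leqNgt divn_gt0 // (dvdn_leq _ mn).
Qed.

Lemma psubst_at0 m p : (psubst m p) 0%N = p 0%N.
Proof. by rewrite /= dvdn0 div0n. Qed.

Lemma psubst_comp m k p : (0 < m)%N -> (0 < k)%N ->
  psubst m (psubst k p) = psubst (k * m) p.
Proof.
move=> m0 k0; apply: pseriesP => n /=.
case: (boolP (m %| n)%N) => [/dvdnP[j ->]|mn].
  by rewrite mulnK // dvdn_pmul2r // divnMr.
by rewrite ifN //; apply: contra mn; apply/dvdn_trans/dvdn_mull.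
Qed.

End Substitution.

(** * Hensel's lemma *)

Section Hensel.
Variable F : fieldType.
Local Notation S := (pseries F).
Implicit Types (g h r : {poly F}) (p q : {poly S}).

(** From a Bezout relation u g + v h = 1, take for the coefficient of h the
    remainder of r v modulo g; the degree of the other coefficient is then
    forced by that of r. *)
Lemma coprime_split g h r : g \is monic -> h \is monic -> coprimep g h ->
    (size r < size (g * h)%R)%N ->
  exists ab : {poly F} * {poly F},
    [/\ (size ab.1 < size g)%N, (size ab.2 < size h)%N
      & ab.1 * h + g * ab.2 = r].
Proof.
move=> mg mh /Bezout_eq1_coprimepP[[u v] /= uv] rs.
have g0 := monic_neq0 mg.
have E : (r * v) %% g * h + g * (r * u + (r * v) %/ g * h) = r.
  transitivity (((r * v) %/ g * g + (r * v) %% g) * h + r * (u * g)); first by ring.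
  by rewrite -divp_eq -[RHS]mulr1 -uv; ring.
exists ((r * v) %% g, r * u + (r * v) %/ g * h); split=> //=.
  by rewrite ltn_modp.
set b := (r * u + _) in E *.
have [->|b0] := eqVneq b 0; first by rewrite size_poly0 size_poly_gt0 monic_neq0.
have : (size (g * b)%R < size (g * h)%R)%N.
  rewrite -[g * b](addKr ((r * v) %% g * h)) E.
  apply: (leq_ltn_trans (size_polyD _ _)); rewrite gtn_max rs andbT size_polyN.
  apply: (leq_ltn_trans (size_polyMleq _ _)); rewrite (size_monicM mg) ?monic_neq0 //.
  have : (size ((r * v) %% g)%R < size g)%N by rewrite ltn_modp.
  have : (0 < size h)%N by rewrite size_poly_gt0 monic_neq0.
  by move: (size h) (size (_ %% _)) (size g) => x y z; lia.
rewrite !(size_monicM mg) ?(monic_neq0 mh) //.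
have : (0 < size g)%N by rewrite size_poly_gt0.
by move: (size b) (size h) (size g) => x y z; lia.
Qed.

(** A polynomial over the power series is also a power series with polynomial
    coefficients, and this is its n-th coefficient. *)
Definition ncoef (p : {poly S}) n : {poly F} := \poly_(i < size p) p`_i n.

Lemma coef_ncoef p n i : (ncoef p n)`_i = p`_i n.
Proof. by rewrite coef_poly; case: ltnP => // pi; rewrite nth_default. Qed.

(** Write p, g and h as power series with polynomial coefficients. The n-th
    coefficient of p = g h is the equation g_n h_0 + g_0 h_n = r, where r is
    known from the earlier coefficients, and [coprime_split] solves it in
    degrees less than those of g_0 and h_0. These degree bounds are what makes
    g and h monic polynomials. *)
Lemma hensel p g0 h0 : p \is monic -> g0 \is monic -> h0 \is monic ->
    coprimep g0 h0 -> map_poly (@pcoef_at0 F) p = g0 * h0 ->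
  exists g h : {poly S},
    [/\ g \is monic, h \is monic, size g = size g0, size h = size h0 & p = g * h].
Proof.
move=> mp mg mh cgh p0.
have szp : size p = size (g0 * h0).
  by rewrite -p0 size_map_poly_id0 // (monicP mp) rmorph1 oner_eq0.
pose T := ({poly F} * {poly F})%type.
pose Q n (f : nat -> T) (x : T) := if n == 0%N then x = (g0, h0) else
  [/\ (size x.1 < size g0)%N, (size x.2 < size h0)%N & x.1 * h0 + g0 * x.2 =
      ncoef p n - \sum_(i < n.-1) (f i.+1).1 * (f (n - i.+1)%N).2].
have [] := @strong_rec_choice T 0 Q.
- move=> [//|n] f f' x ff' [? ? E]; split => //; rewrite E; congr (_ - _).
  by apply: eq_bigr => i _; rewrite !ff' ?subSS ?ltnS ?leq_subr //.
- move=> [|n] f IH; first by exists (g0, h0).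
  apply: coprime_split => //.
  have sz0 : (0 < size (g0 * h0)%R)%N by rewrite -szp size_poly_gt0 monic_neq0.
  apply: (leq_ltn_trans (size_polyD _ _)); rewrite gtn_max size_polyN.
  apply/andP; split.
    rewrite -szp in sz0 *; rewrite -(prednK sz0) ltnS; apply/leq_sizeP => j.
    rewrite leq_eqVlt => /orP[/eqP <-|pj]; rewrite coef_ncoef.
      by have /monicP := mp; rewrite /lead_coef => ->.
    by rewrite nth_default // -(prednK sz0).
  rewrite -(prednK sz0) ltnS; apply: (leq_trans (size_sum _ _ _)).
  apply/bigmax_leqP => i _; apply: (leq_trans (size_polyMleq _ _)).
  have [|s1 _ _] := IH i.+1 _; first by rewrite ltnS.
  have : Q (n - i)%N f (f (n - i)%N) by apply: IH; rewrite ltnS leq_subr.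
  rewrite /Q ifN -?lt0n ?subn_gt0 // subSS => -[_ s2 _].
  rewrite (size_monicM mg) ?monic_neq0 //.
  move: s1 s2; move: (size (f i.+1).1) (size (f (n - i)%N).2).
  by move: (size g0) (size h0) => x y z t; lia.
move=> f fP.
have f0 : f 0%N = (g0, h0) by exact: (fP 0%N).
have sg n : (size (f n).1 <= size g0)%N.
  by case: n => [|n]; [rewrite f0|case: (fP n.+1) => /ltnW].
have sh n : (size (f n).2 <= size h0)%N.
  by case: n => [|n]; [rewrite f0|case: (fP n.+1) => _ /ltnW].
have fS n : ncoef p n = \sum_(j < n.+1) (f j).1 * (f (n - j)%N).2.
  case: n => [|n].
    rewrite big_ord1 f0 -p0; apply/polyP => i.
    by rewrite coef_ncoef.
  rewrite big_ord_recl big_ord_recr /= subn0 subnn f0 /=.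
  have [_ _ /= E] := fP n.+1; rewrite addrCA [g0 * _ + _]addrC E.
  by rewrite addrC subrK.
(* The two sequences of polynomials are read as polynomials over the series. *)
pose g : {poly S} := \poly_(i < size g0) PSeries (fun n => (f n).1`_i).
pose h : {poly S} := \poly_(i < size h0) PSeries (fun n => (f n).2`_i).
have gE i n : g`_i n = (f n).1`_i.
  rewrite coef_poly; case: ltnP => // ig; rewrite nth_default //.
  exact: leq_trans ig.
have hE i n : h`_i n = (f n).2`_i.
  rewrite coef_poly; case: ltnP => // ig; rewrite nth_default //.
  exact: leq_trans ig.
have top (q : {poly F}) (k : nat -> {poly F}) : q \is monic -> k 0%N = q ->
    (forall n, (size (k n.+1) < size q)%N) ->
    (PSeries (fun n => (k n)`_(size q).-1) = 1).
  move=> mq k0 sk; apply: pseriesP => -[|n] /=.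
    by rewrite k0 -/(lead_coef q) (monicP mq).
  by rewrite nth_default // -ltnS (leq_trans (sk n)) // leqSpred.
have mon (q : {poly F}) (k : nat -> {poly F}) : q \is monic -> k 0%N = q ->
    (forall n, (size (k n.+1) < size q)%N) ->
    let r := \poly_(i < size q) PSeries (fun n => (k n)`_i) in
    r \is monic /\ size r = size q.
  move=> mq k0 sk r; have T1 := top _ _ mq k0 sk.
  have sq : (0 < size q)%N by rewrite size_poly_gt0 monic_neq0.
  have szr : size r = size q.
    by rewrite size_poly_eq // T1 oner_eq0.
  split=> //; rewrite monicE /lead_coef szr coef_poly.
  by rewrite prednK // leqnn T1.
have sg' n : (size (f n.+1).1 < size g0)%N by have [] := fP n.+1.
have sh' n : (size (f n.+1).2 < size h0)%N by have [] := fP n.+1.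
have [mong szg] := mon g0 (fun n => (f n).1) mg (congr1 fst f0) sg'.
have [monh szh] := mon h0 (fun n => (f n).2) mh (congr1 snd f0) sh'.
exists g, h; split=> //; apply/polyP => k; apply: pseriesP => n.
rewrite -coef_ncoef fS coef_sum coefM.
rewrite pcoef_sum; under eq_bigr => j _ do rewrite coefM.
rewrite exchange_big /=; apply: eq_bigr => i _.
by apply: eq_bigr => j _; rewrite gE hE.
Qed.
End Hensel.

(** * Puiseux's theorem *)

Lemma coef_XsubC_exp_subleading (R : comNzRingType) (c : R) d :
  (('X - c%:P) ^+ d.+1)`_d = - (c *+ d.+1).
Proof.
have := @coefPn_prod_XsubC R (nseq d.+1 c); rewrite size_nseq /= => /(_ isT).
by rewrite -[_ :: _]/(nseq d.+1 c) !big_nseq iter_addr_0 iter_mulr_1.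
Qed.

Section Puiseux.
Variable F : closedFieldType.
Hypothesis charF : [pchar F] =i pred0.
Local Notation S := (pseries F).
Implicit Types (p q : {poly S}).

(** The shift by the subleading coefficient divided by the degree is available
    in characteristic 0. *)
Lemma tschirnhaus p d : p \is monic -> size p = d.+2 ->
  exists c : S, let q := p \Po ('X - c%:P) in
    [/\ q \is monic, size q = d.+2 & q`_d = 0].
Proof.
move=> mp sp; pose c : S := pconst ((d.+1)%:R^-1) * p`_d.
have lp : p`_d.+1 = 1 by move/monicP: mp; rewrite /lead_coef sp.
exists c => q.
have sq : size q = d.+2.
  by rewrite size_comp_poly2 // size_XsubC.
have mq : q \is monic.
  rewrite monicE lead_coef_comp ?size_XsubC // (monicP mp) lead_coefXsubC.
  by rewrite expr1n mulr1.
split=> //.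
rewrite /q (comp_polyE p) sp coef_sum big_ord_recr big_ord_recr /=.
rewrite big1 ?add0r => [|i _]; last first.
  rewrite coefZ [X in _ * X]nth_default ?mulr0 //.
  by rewrite size_exp_XsubC.
rewrite !coefZ lp mul1r coef_XsubC_exp_subleading.
have := monicP (monic_exp d (monicXsubC c)); rewrite /lead_coef size_exp_XsubC /= => ->.
rewrite mulr1 /c -mulrnAl -rmorphMn /= -mulr_natl divff ?rmorph1 ?mul1r ?subrr //.
by rewrite ((pcharf0P _).1 charF).
Qed.

(** The ratio k / (d - i0) is the smallest among all n / (d - i) such that t^n
    occurs in the coefficient of x^i: it is a slope of the Newton polygon. *)
Lemma newton_slope p d : p != 'X^d -> p \is monic -> size p = d.+1 ->
  exists i0 k, [/\ (i0 < d)%N, p`_i0 k != 0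
    & forall i n, (i < d)%N -> p`_i n != 0 -> (k * (d - i) <= n * (d - i0))%N].
Proof.
move=> pXd mp sp.
have lp : p`_d = 1 by move/monicP: mp; rewrite /lead_coef sp.
(* The slope n / (d - i), multiplied by d! to make it an integer. *)
pose w i n := (n * (d`! %/ (d - i)))%N.
pose P v := `[< exists i n, [/\ (i < d)%N, p`_i n != 0 & w i n = v] >].
have exP : exists v, P v.
  apply: contrapT => no; case/eqP: pXd; apply/polyP => i.
  rewrite coefXn; case: (ltngtP i d) => [id|di|->] //=; last first.
    by rewrite nth_default // sp.
  apply: pseriesP => n; rewrite pcoef0; apply/eqP; apply: contrapT => /negP pin.
  by apply: no; exists (w i n); apply/asboolP; exists i, n.
case: (ex_minnP exP) => v /asboolP[i0 [k [i0d pk <-]]] vmin.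
exists i0, k; split=> // i n id pin.
have {vmin} : (w i0 k <= w i n)%N by apply: vmin; apply/asboolP; exists i, n.
have D j : (j < d)%N -> (d`! = d`! %/ (d - j) * (d - j))%N.
  by move=> jd; rewrite divnK // dvdn_fact // subn_gt0 jd leq_subr.
rewrite /w => le; rewrite -(@leq_pmul2r d`!) ?fact_gt0 //.
have -> : (k * (d - i) * d`! = k * (d`! %/ (d - i0)) * ((d - i) * (d - i0)))%N.
  by rewrite {1}(D i0) //; ring.
have -> : (n * (d - i0) * d`! = n * (d`! %/ (d - i)) * ((d - i) * (d - i0)))%N.
  by rewrite {1}(D i) //; ring.
exact: leq_mul.
Qed.

(** With slope k / m the substitutions t := t^m and x := t^k x make every
    coefficient of [p] divisible by the power of t that the leading term
    acquires. After division by it, the coefficient of index [i0] that realizes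
    the slope has become a unit, so that the residue of [q] is not a power
    of x. *)
Lemma newton_rescale p d : p != 'X^d -> p \is monic -> size p = d.+1 ->
  exists m k q i0,
    [/\ (0 < m)%N, q \is monic /\ size q = d.+1, (i0 < d)%N /\ q`_i0 0%N != 0,
        forall i, p`_i = 0 -> q`_i = 0
      & map_poly (psubst m) p \Po (pvar ^+ k *: 'X) = pvar ^+ (k * d) *: q].
Proof.
move=> pXd mp sp; have [i0 [k [i0d pk slope]]] := newton_slope pXd mp sp.
have lp : p`_d = 1 by move/monicP: mp; rewrite /lead_coef sp.
pose m := (d - i0)%N; have m0 : (0 < m)%N by rewrite subn_gt0.
pose q := \poly_(i < d.+1) pshift (k * (d - i)) (psubst m p`_i).
have qd : q`_d = 1.
  rewrite coef_poly ltnSn lp rmorph1 subnn muln0; apply: pseriesP => n /=.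
  by rewrite addn0.
have sq : size q = d.+1.
  apply/eqP; rewrite eqn_leq size_poly /= ltnNge; apply/negP => /leq_sizeP/(_ d).
  by rewrite leqnn qd => /(_ isT)/eqP; rewrite oner_eq0.
exists m, k, q, i0; split=> //.
- by split=> //; rewrite monicE /lead_coef sq qd.
- split=> //; rewrite coef_poly (ltn_trans i0d) //= add0n dvdn_mull //.
  by rewrite mulnK.
- by move=> i pi0; rewrite coef_poly pi0 rmorph0; case: ifP.
have smp : size (map_poly (psubst m) p) = d.+1.
  by rewrite size_map_poly_id0 // (monicP mp) rmorph1 oner_eq0.
rewrite comp_polyE smp [q in RHS]poly_def scaler_sumr; apply: eq_bigr => i _.
rewrite coef_map exprZn !scalerA -exprM; congr (_ *: _); rewrite /=.
rewrite -[psubst m p`_i in LHS](@pshiftK _ (k * (d - i))); last first.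
  move=> n nk /=; case: ifP => // /dvdnP[j nE]; rewrite nE mulnK //.
  apply/eqP; apply: contraLR nk => pij; rewrite -leqNgt nE.
  have [id|] := ltnP i d; first exact: slope.
  by rewrite -subn_eq0 => /eqP->; rewrite muln0.
rewrite mulrAC -exprD; congr (pvar ^+ _ * _).
by rewrite -mulnDr subnK // -ltnS.
Qed.

(** The field of Puiseux series is algebraically closed. Induction on the degree:
    once the subleading coefficient is 0, either p = x^d, or rescaling along the
    Newton polygon gives a polynomial with residue other than x^d. This residue
    is not a d-th power (x - a)^d either, because the subleading coefficient
    - d a vanishes only for a = 0. So a root a of the residue splits it into
    coprime factors (x - a)^mu and h with mu < d; they lift by [hensel], and the
    induction hypothesis applies to the lift of the first one. *)
Theorem puiseux_root p : p \is monic -> (1 < size p)%N ->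
  exists m (b : S), (0 < m)%N /\ root (map_poly (psubst m) p) b.
Proof.
have [n] := ubnP (size p); elim: n p => // n IH p.
rewrite ltnS => pn mp; case sp : (size p) pn => [|[|d]] // pn _.
have [c [mq sq qd]] := tschirnhaus mp sp; set q := p \Po _ in mq sq qd.
suff [m [b [m0 qb]]] :
    exists m (b : S), (0 < m)%N /\ root (map_poly (psubst m) q) b.
  exists m, (b - psubst m c); split=> //; move: qb.
  rewrite /root /q map_comp_poly horner_comp.
  by rewrite rmorphB /= map_polyX map_polyC /= hornerXsubC.
have [->|qX] := eqVneq q 'X^(d.+1).
  by exists 1%N, 0; split=> //; rewrite map_polyXn /root hornerXn expr0n.
have [m [k [r [i0 [m0 [mr sr] [i0d ri0] rd rq]]]]] := newton_rescale qX mq sq.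
suff [m' [b [m'0 rb]]] :
    exists m (b : S), (0 < m)%N /\ root (map_poly (psubst m) r) b.
  exists (m * m')%N, (psubst m' (pvar ^+ k) * b); split; first by rewrite muln_gt0 m0.
  have E : map_poly (psubst (m * m')) q =
      map_poly (psubst m') (map_poly (psubst m) q).
    by apply/polyP => i; rewrite !coef_map /= psubst_comp.
  have := congr1 (fun u => (map_poly (psubst m') u).[b]) rq.
  rewrite E /root map_comp_poly horner_comp !map_polyZ map_polyX !hornerZ hornerX.
  by rewrite (rootP rb) mulr0 => ->.
pose r0 := map_poly (@pcoef_at0 F) r.
have mr0 : r0 \is monic by apply: monic_map.
have sr0 : size r0 = d.+2.
  by rewrite size_map_poly_id0 ?sr // (monicP mr) rmorph1 oner_eq0.
have [a ra] : exists a, root r0 a by apply/closed_rootP; rewrite sr0.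
have [mu [h nha rE]] := multiplicity_XsubC r0 a.
rewrite monic_neq0 //= in nha.
have mh : h \is monic.
  by move: mr0; rewrite rE monicMr // monic_exp // monicXsubC.
have cop : coprimep h (('X - a%:P) ^+ mu).
  by apply: coprimep_expr; rewrite coprimep_XsubC.
have szr0 : (size h + mu = d.+2)%N.
  rewrite -sr0 rE size_Mmonic ?monic_neq0 ?monic_exp ?monicXsubC //.
  by rewrite size_exp_XsubC addnS.
have mu0 : (0 < mu)%N.
  case: (mu) rE => // rE; move: nha.
  by rewrite -[h]mulr1 -[1](expr0 ('X - a%:P)) -rE ra.
have mud : (mu <= d)%N.
  rewrite leqNgt; apply/negP => dmu.
  have h1 : h = 1.
    have sh : size h = 1%N.
      apply/eqP; rewrite eqn_leq size_poly_gt0 (monic_neq0 mh) andbT.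
      by rewrite -(leq_add2r mu) szr0 add1n ltnS.
    move/monicP: mh; rewrite /lead_coef sh /= => h0.
    by rewrite [h]size1_polyC ?sh ?h0.
  have muE : mu = d.+1 by move: szr0; rewrite h1 size_poly1; case.
  have a0 : a = 0.
    have : r0`_d = 0 by rewrite coef_map rd ?raddf0.
    rewrite rE h1 mul1r muE coef_XsubC_exp_subleading => /eqP.
    by rewrite oppr_eq0 -mulr_natl mulf_eq0 ((pcharf0P _).1 charF) => /eqP.
  case/negP: ri0; have : r0`_i0 = (r`_i0) 0%N by rewrite coef_map.
  by move=> <-; rewrite rE h1 a0 subr0 mul1r muE coefXn ltn_eqF.
have mX : ('X - a%:P) ^+ mu \is monic by rewrite monic_exp // monicXsubC.
have [h' [g [mh' mg sh' sg rhg]]] := hensel mr mh mX cop rE.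
rewrite size_exp_XsubC in sg.
have [||m' [b [m'0 gb]]] := IH g _ mg; rewrite ?sg //.
  by apply: leq_trans pn; rewrite !ltnS.
by exists m', b; split=> //; rewrite rhg rmorphM /= rootM gb orbT.
Qed.
End Puiseux.

(** * Fractions of power series *)

Section FractionLift.
Variable R : idomainType.
Local Notation "a %:F" := (@tofrac R a).

Lemma fraction_eq (x : {fraction R}) :
  exists2 ab : R * R, ab.2 != 0 & x = ab.1%:F / ab.2%:F.
Proof.
elim/quotW: x => r; exists (\n_r, \d_r) => /=; first exact: denom_ratioP.
have d0 : (\d_r)%:F != 0 by rewrite tofrac_eq0 denom_ratioP.
apply: (canRL (mulfK d0)); unlock tofrac; rewrite -[LHS]/(FracField.mul _ _).
rewrite -FracField.pi_mul; apply/eqmodP.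
rewrite /= FracField.equivfE /FracField.mulf.
by rewrite !numden_Ratio ?mulr1 ?oner_neq0 ?denom_ratioP // mulrC.
Qed.

Lemma common_denominator (I : finType) (x : I -> {fraction R}) :
  exists2 d : R, d != 0 & exists a : I -> R, forall i, d%:F * x i = (a i)%:F.
Proof.
have /choice[ab abP] i : exists ab : R * R, ab.2 != 0 /\ x i = ab.1%:F / ab.2%:F.
  by have [ab ? ?] := fraction_eq (x i); exists ab.
exists (\prod_i (ab i).2).
  by apply/prodf_neq0 => i _; case: (abP i).
exists (fun i => \prod_(j | j != i) (ab j).2 * (ab i).1) => i.
have [d0 ->] := abP i; rewrite (bigD1 i) //= !rmorphM /= mulrC mulrA divfK.
  exact: mulrC.
by rewrite tofrac_eq0.
Qed.

Lemma fraction_lift (L : fieldType) (phi : {rmorphism R -> L}) : injective phi ->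
  exists Phi : {rmorphism {fraction R} -> L}, forall a, Phi a%:F = phi a.
Proof.
move=> phi_inj.
have phi0 a : a != 0 -> phi a != 0.
  by move=> a0; rewrite -(rmorph0 phi) (inj_eq phi_inj).
have /choice[ab abP] x : exists ab : R * R, ab.2 != 0 /\ x = ab.1%:F / ab.2%:F.
  by have [ab ? ?] := fraction_eq x; exists ab.
pose Phi x := phi (ab x).1 / phi (ab x).2.
have PhiE a b : b != 0 -> Phi (a%:F / b%:F) = phi a / phi b.
  move=> b0; rewrite /Phi; move: (abP (a%:F / b%:F)).
  case: (ab _) => c d /= [d0 /eqP].
  rewrite eqr_div ?tofrac_eq0 // -!rmorphM tofrac_eq => /eqP E.
  by apply/eqP; rewrite eqr_div ?phi0 // -!rmorphM -E.
have PhiF a : Phi a%:F = phi a.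
  by rewrite -[a%:F]divr1 -[1]/(1%:F) PhiE ?oner_eq0 // rmorph1 divr1.
have PhiB : zmod_morphism Phi.
  move=> x y; have [[a b] /= b0 ->] := fraction_eq x.
  have [[c d] /= d0 ->] := fraction_eq y.
  have subf_div (K : fieldType) (s t u v : K) : t != 0 -> v != 0 ->
      s / t - u / v = (s * v - u * t) / (t * v).
    by move=> t0 v0; rewrite -mulNr addf_div // mulNr.
  rewrite subf_div ?tofrac_eq0 // -!rmorphM -rmorphB !PhiE ?mulf_neq0 //.
  by rewrite subf_div ?phi0 // -!rmorphM -rmorphB.
have PhiM : monoid_morphism Phi.
  split; first by rewrite -[1]/(1%:F) PhiF rmorph1.
  move=> x y; have [[a b] /= b0 ->] := fraction_eq x.
  have [[c d] /= d0 ->] := fraction_eq y.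
  by rewrite mulf_div -!rmorphM !PhiE ?mulf_neq0 // mulf_div -!rmorphM.
pose Phi' : {rmorphism {fraction R} -> L} :=
  HB.pack Phi (GRing.isZmodMorphism.Build _ _ Phi PhiB)
    (GRing.isMonoidMorphism.Build _ _ Phi PhiM).
by exists Phi'.
Qed.
End FractionLift.

(** A power of t suffices as a denominator, because every nonzero series is a
    power of t times a unit. *)
Lemma uniform_denominator (F : fieldType) n (H : 'M[{fraction pseries F}]_n) :
  exists M (h : 'M[pseries F]_n),
    forall i j, tofrac (h i j) = tofrac (pvar ^+ M) * H i j.
Proof.
have [D D0 [a aE]] := common_denominator (fun ij : 'I_n * 'I_n => H ij.1 ij.2).
have [M [u [uu DE]]] := pseries_valuation D0.
exists M, (\matrix_(i, j) (u^-1 * a (i, j))) => i j.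
rewrite mxE rmorphM /= -aE DE mulrA -rmorphM; congr (tofrac _ * _).
by rewrite mulrCA mulVr // mulr1.
Qed.

(** * Specialization of algebraic elements *)

Section AlgebraicExtensions.
Variables (E K : fieldType) (iota : {rmorphism E -> K}).
Implicit Types p : {poly E}.

Lemma minimal_polynomial z : algebraicOver iota z -> exists nu,
  [/\ nu \is monic, (1 < size nu)%N, root (map_poly iota nu) z
    & forall p, root (map_poly iota p) z -> nu %| p].
Proof.
move=> [p p0 pz].
pose P k := `[< exists p, [/\ p != 0, root (map_poly iota p) z & size p = k] >].
have exP : exists k, P k by exists (size p); apply/asboolP; exists p.
case: (ex_minnP exP) => k /asboolP[mu [mu0 muz smu]] kmin.
have mudvd q : root (map_poly iota q) z -> mu %| q.
  move=> qz; rewrite /dvdp; apply: contrapT => /negP r0.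
  have : (k <= size (q %% mu)%R)%N.
    apply: kmin; apply/asboolP; exists (q %% mu); split=> //.
    move: qz; rewrite {1}(divp_eq q mu) rmorphD rmorphM /= /root hornerD hornerM.
    by rewrite (rootP muz) mulr0 add0r.
  by rewrite leqNgt -smu ltn_modp mu0.
have smu1 : (1 < k)%N.
  rewrite -smu ltnNge; apply/negP => /size1_polyC muC; move: muz mu0.
  rewrite muC map_polyC /root hornerC polyC_eq0 fmorph_eq0 => /eqP->.
  by rewrite eqxx.
exists ((lead_coef mu)^-1 *: mu); split=> [|||q qz].
- by rewrite monicE lead_coefZ mulVf ?lead_coef_eq0.
- by rewrite size_scale ?smu // invr_eq0 lead_coef_eq0.
- by rewrite map_polyZ /root hornerZ (rootP muz) mulr0.
- by rewrite dvdpZl ?mudvd // invr_eq0 lead_coef_eq0.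
Qed.

(** The two kernels coincide because the minimal polynomial of [z] generates
    the first one and generates a maximal ideal: if it did not divide a
    polynomial that vanishes at [b], a Bezout relation would give 1 = 0 at [b]. *)
Lemma minimal_polynomial_specialization (L : fieldType) (sigma : {rmorphism E -> L})
    (nu : {poly E}) z b : nu \is monic -> root (map_poly iota nu) z ->
    (forall p, root (map_poly iota p) z -> nu %| p) ->
    root (map_poly sigma nu) b ->
  forall p, ((map_poly iota p).[z] == 0) = ((map_poly sigma p).[b] == 0).
Proof.
move=> mnu nuz nudvd nub p.
apply/idP/idP => [/nudvd /dvdpP[r ->]|pb].
  by rewrite rmorphM /= hornerM (rootP nub) mulr0.
have [|ncop] := boolP (coprimep nu p).
  move=> /Bezout_eq1_coprimepP[[u v] /= uv].
  have /eqP := congr1 (fun w => (map_poly sigma w).[b]) uv.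
  rewrite rmorphD !rmorphM rmorph1 /= hornerD !hornerM (rootP nub) (eqP pb) hornerC.
  by rewrite !mulr0 addr0 eq_sym oner_eq0.
have gz : root (map_poly iota (gcdp nu p)) z.
  have /dvdpP[r rE] := dvdp_gcdl nu p.
  apply: contraR ncop => gz.
  have rz : root (map_poly iota r) z.
    by move: nuz; rewrite {1}rE rmorphM rootM (negPf gz) orbF.
  have /dvdpP[w wE] := nudvd _ rz.
  have r0 : r != 0.
    apply: contraTneq mnu => r0.
    by rewrite rE r0 mul0r monicE lead_coef0 eq_sym oner_eq0.
  rewrite /coprimep -dvdp1; apply/dvdpP; exists w; apply: (mulfI r0).
  by rewrite mulr1 {1}wE {1}rE; ring.
have /dvdpP[r ->] := dvdp_gcdr nu p.
by rewrite rmorphM /= hornerM (rootP gz) mulr0.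
Qed.

Hypothesis charE : [pchar E] =i pred0.
Hypothesis algK : forall x, algebraicOver iota x.

(** The primitive element theorem for two elements, used to adjoin the members
    of the family one at a time. *)
Lemma primitive_element (I : finType) (G : I -> K) :
  exists z, exists q : I -> {poly E}, forall i, (map_poly iota (q i)).[z] = G i.
Proof.
suff H n (G' : 'I_n -> K) :
    exists z, exists q : 'I_n -> {poly E}, forall i, (map_poly iota (q i)).[z] = G' i.
  have [z [q qE]] := H _ (fun i : 'I_#|I| => G (enum_val i)).
  by exists z, (q \o enum_rank) => i; rewrite /= qE /= enum_rankK.
elim: n G' => {G} [|n IH] G; first by exists 0, (fun=> 0) => -[].
have [z [q qE]] := IH (fun i => G (lift ord0 i)).
have [p1 p10 p1z] := algK z; have [p2 p20 p2G] := algK (G ord0).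
have [k /= [[r rz] [s sG]]] := pchar0_PET p10 p1z p20 p2G charE.
set y := _ *+ _ - _ in rz sG.
exists y, (fun i => if unlift ord0 i is Some j then q j \Po r else s) => i.
case: unliftP => [j ->|-> //].
by rewrite map_comp_poly horner_comp rz qE.
Qed.

End AlgebraicExtensions.

Section Specialization.
Variable F : closedFieldType.
Hypothesis charF : [pchar F] =i pred0.
Local Notation S := (pseries F).
Local Notation Fr := {fraction S}.
Local Notation "a %:F" := (@tofrac S a).

(** A common denominator D of the coefficients makes D^d p(x / D) a monic
    polynomial over the power series. *)
Lemma puiseux_root_fraction (p : {poly Fr}) : p \is monic -> (1 < size p)%N ->
  exists m, (0 < m)%N /\ forall sigma : {rmorphism Fr -> Fr},
    (forall a : S, sigma a%:F = (psubst m a)%:F) ->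
    exists b, root (map_poly sigma p) b.
Proof.
move=> mp sp1; case sp : (size p) sp1 => [|[|d]] // _.
have lp : p`_d.+1 = 1 by move/monicP: mp; rewrite /lead_coef sp.
have [D D0 [a aE]] := common_denominator (fun i : 'I_d.+2 => p`_i).
have DF0 : D%:F != 0 by rewrite tofrac_eq0.
pose r : {poly S} := \poly_(i < d.+1) (a (inord i) * D ^+ (d - i)).
pose q : {poly S} := 'X^(d.+1) + r.
have szr : (size r < size ('X^(d.+1) : {poly S})%R)%N.
  by rewrite size_polyXn ltnS size_poly.
have sq : size q = d.+2 by rewrite size_polyDl // size_polyXn.
have mq : q \is monic by rewrite monicE lead_coefDl // lead_coefXn.
have qE : map_poly (@tofrac S) q = D%:F ^+ d.+1 *: (p \Po (D%:F^-1 *: 'X)).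
  rewrite comp_polyE sp scaler_sumr rmorphD /= map_polyXn addrC big_ord_recr /=.
  rewrite lp scale1r !exprZn !scalerA mulrC -exprMn mulVf // expr1n scale1r.
  congr (_ + _); rewrite /r poly_def rmorph_sum /=; apply: eq_bigr => i _.
  rewrite -mul_polyC rmorphM /= map_polyC map_polyXn /= mul_polyC exprZn !scalerA.
  congr (_ *: _); rewrite rmorphM rmorphXn /=.
  rewrite -[X in a X](_ : widen_ord (leqnSn _) i = _); last first.
    by apply: val_inj; rewrite /= inordK // ltnS ltnW.
  have -> : D%:F ^+ d.+1 = D%:F ^+ (d - i).+1 * D%:F ^+ i.
    by rewrite -exprD; congr (_ ^+ _); have := ltn_ord i; lia.
  rewrite -aE /= exprVn [RHS]mulrAC mulfK ?expf_neq0 // exprS.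
  by rewrite mulrAC.
have [|m [b [m0 qb]]] := puiseux_root charF mq; first by rewrite sq.
exists m; split=> // sigma sE.
have sD0 : sigma D%:F != 0 by rewrite fmorph_eq0.
exists (b%:F / sigma D%:F).
have E : map_poly sigma (map_poly (@tofrac S) q) =
    map_poly (@tofrac S) (map_poly (psubst m) q).
  by apply/polyP => i; rewrite !coef_map /= sE.
have := congr1 (fun u => (map_poly sigma u).[b%:F]) qE.
rewrite E horner_map (rootP qb) rmorph0 map_polyZ hornerZ map_comp_poly horner_comp.
rewrite map_polyZ map_polyX hornerZ hornerX fmorphV [_^-1 * _]mulrC => /esym/eqP.
by rewrite mulf_eq0 fmorph_eq0 expf_eq0 (negPf DF0) andbF.
Qed.

Variables (K : closedFieldType) (iota : {rmorphism Fr -> K}).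
Hypothesis algK : is_algebraic_closure iota.

(** Every finite family [G] of elements of the algebraic closure has a model over
    the Laurent series in t^(1/m): write its members as polynomials [q i] in one
    algebraic element z, and evaluate these at a root b of the minimal
    polynomial of z, twisted by t := t^m. The evaluation [ev1] at z and the
    evaluation [ev2] at b have the same kernel, so that every polynomial
    identity and every inequation between the members of [G] is inherited by the
    elements [ev2 (q i)]. *)
Theorem puiseux_specialization (I : finType) (G : I -> K) :
  exists m (ev1 : {rmorphism {poly Fr} -> K}) (ev2 : {rmorphism {poly Fr} -> Fr})
      (q : I -> {poly Fr}),
    [/\ (0 < m)%N, forall x : Fr, ev1 x%:P = iota x,
        forall a : S, ev2 (a%:F)%:P = (psubst m a)%:F,
        forall i, ev1 (q i) = G i
      & forall p, (ev1 p == 0) = (ev2 p == 0)].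
Proof.
have charFr : [pchar Fr] =i pred0.
  by move=> k; rewrite (fmorph_pchar (@tofrac S \o @pconst F)).
have [z [q qE]] := primitive_element charFr algK G.
have [nu [mnu snu nuz nudvd]] := minimal_polynomial (algK z).
have [m [m0 mP]] := puiseux_root_fraction mnu snu.
have phi_inj : injective (@tofrac S \o psubst m).
  by move=> x y /eqP; rewrite /= tofrac_eq => /eqP /(psubst_inj m0).
have [sigma sE] := fraction_lift phi_inj.
have [b nub] := mP sigma sE.
exists m, (horner_eval z \o map_poly iota), (horner_eval b \o map_poly sigma), q.
split=> // [x|a|p].
- by rewrite /= /horner_eval map_polyC hornerC.
- by rewrite /= /horner_eval map_polyC hornerC /= sE.
- rewrite [LHS]/= [RHS]/= /horner_eval.
  exact: (minimal_polynomial_specialization mnu nuz nudvd nub p).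
Qed.
End Specialization.

(** * Bases and semilinear maps *)

Section Coordinates.
Variables (S : nzRingType) (M : lmodType S) (n : nat) (v : 'I_n -> M).

Lemma lin_indep_inj (a b : 'I_n -> S) : lin_indep v ->
  \sum_i a i *: v i = \sum_i b i *: v i -> forall i, a i = b i.
Proof.
move=> vi /eqP; rewrite -subr_eq0 -sumrB => /eqP E i; apply/eqP.
rewrite -subr_eq0; apply/eqP; apply: (vi (fun i => a i - b i)); rewrite -[RHS]E.
by apply: eq_bigr => j _; rewrite scalerBl.
Qed.

Lemma basis_coordinates : is_basis_of (fun _ => True) v ->
  exists c : M -> 'I_n -> S, [/\ forall x, x = \sum_i c x i *: v i,
    forall s x y i, c (s *: x + y) i = s * c x i + c y i
    & forall i j, c (v j) i = (i == j)%:R].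
Proof.
move=> [_ vi vs].
have /choice[c cE] x : exists a : 'I_n -> S, x = \sum_i a i *: v i by apply: vs.
have uniq a x : x = \sum_i a i *: v i -> forall i, c x i = a i.
  by move=> xE; apply: lin_indep_inj; rewrite // -xE -cE.
exists c; split=> // [s x y|i j].
  apply: uniq; rewrite [in LHS](cE x) [in LHS](cE y) scaler_sumr -big_split.
  by apply: eq_bigr => i _; rewrite scalerDl scalerA.
rewrite (uniq (fun i => (i == j)%:R)) // (bigD1 j) //= eqxx scale1r.
by rewrite big1 ?addr0 // => k /negPf->; rewrite scale0r.
Qed.

End Coordinates.

Section SemilinearMaps.
Variables (S K : comNzRingType) (phi : {rmorphism S -> K}).
Variables (M : lmodType S) (n : nat) (v : 'I_n -> M).

Lemma semilinear_sum (Q : lmodType K) (g : {linear M -> Q | phi \; *:%R})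
  (a : 'I_n -> S) : g (\sum_i a i *: v i) = \sum_i phi (a i) *: g (v i).
Proof. by rewrite raddf_sum /=; apply: eq_bigr => i _; rewrite linearZ_LR. Qed.

Hypothesis v_basis : is_basis_of (fun _ => True) v.

Lemma basis_extension (Q : lmodType K) (w : 'I_n -> Q) :
  exists g : {linear M -> Q | phi \; *:%R}, forall i, g (v i) = w i.
Proof.
have [c [cE cL cv]] := basis_coordinates v_basis.
pose g x := \sum_i phi (c x i) *: w i.
have gL : GRing.linear_for (phi \; *:%R) g.
  move=> s x y; rewrite /g /= scaler_sumr -big_split; apply: eq_bigr => i _.
  by rewrite cL rmorphD rmorphM scalerDl scalerA.
pose g' : {linear M -> Q | phi \; *:%R} :=
  HB.pack g (GRing.isLinear.Build _ _ _ _ g gL).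
exists g' => i; rewrite /= /g (bigD1 i) //= cv eqxx rmorph1 scale1r.
by rewrite big1 ?addr0 // => j /negPf ji; rewrite cv ji rmorph0 scale0r.
Qed.

Lemma semilinear_inj (Q : lmodType K) (g : {linear M -> Q | phi \; *:%R}) :
  injective phi -> lin_indep (fun i => g (v i)) -> injective g.
Proof.
move=> phi_inj gi; apply: raddf_inj => x.
have [_ _ /(_ x I) [a ->]] := v_basis.
rewrite /= semilinear_sum => /gi a0; apply: big1 => i _.
by rewrite (phi_inj _ _ (etrans (a0 i) (esym (rmorph0 phi)))) scale0r.
Qed.

End SemilinearMaps.

Section SemilinearAlgebraMaps.
Variables (S K : comNzRingType) (phi : {rmorphism S -> K}).
Variables (M : algType S) (n : nat) (v : 'I_n -> M).
Hypothesis v_basis : is_basis_of (fun _ => True) v.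

Lemma basis_multiplicative (B : algType K) (g : {linear M -> B | phi \; *:%R}) :
  (forall i j, g (v i * v j) = g (v i) * g (v j)) -> {morph g : x y / x * y}.
Proof.
move=> gv x y; have [_ _ vs] := v_basis.
have [[a ->] [b ->]] := (vs x I, vs y I).
rewrite !(semilinear_sum _ g) mulr_suml raddf_sum mulr_suml.
apply: eq_bigr => i _; rewrite !mulr_sumr raddf_sum.
apply: eq_bigr => j _ /=; rewrite -!(scalerAl, scalerAr) scalerA.
by rewrite linearZ_LR /= gv scalerA rmorphM.
Qed.

Lemma basis_algebra_extension (B : algType K) (w : 'I_n -> B)
    (a : 'I_n -> 'I_n -> 'I_n -> S) (u : 'I_n -> S) :
    (forall i j, v i * v j = \sum_k a i j k *: v k) ->
    (forall i j, w i * w j = \sum_k phi (a i j k) *: w k) ->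
    1 = \sum_i u i *: v i -> 1 = \sum_i phi (u i) *: w i ->
  exists g : {lrmorphism M -> B | phi \; *:%R}, forall i, g (v i) = w i.
Proof.
move=> va wa vu wu; have [g gv] := basis_extension phi v_basis w.
have gM : {morph g : x y / x * y}.
  apply: basis_multiplicative => i j.
  rewrite va semilinear_sum !gv wa.
  by apply: eq_bigr => k _; rewrite gv.
have g1 : g 1 = 1.
  by rewrite vu semilinear_sum wu; apply: eq_bigr => i _; rewrite gv.
have gL : GRing.linear_for (phi \; *:%R) (g : M -> B).
  by move=> s x y; rewrite raddfD /= linearZ_LR.
pose g' : {lrmorphism M -> B | phi \; *:%R} :=
  HB.pack (g : M -> B) (GRing.isLinear.Build _ _ _ _ (g : M -> B) gL)
    (GRing.isMonoidMorphism.Build _ _ (g : M -> B) (g1, gM)).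
by exists g'.
Qed.
End SemilinearAlgebraMaps.

(** Row vector times matrix, for matrices that express a family [w] in a
    family [x]. *)
Lemma combination_sum (T : comNzRingType) (M : lmodType T) n (x : 'I_n -> M)
    (G : 'I_n -> 'I_n -> T) (a : 'I_n -> T) :
  \sum_k a k *: (\sum_p G k p *: x p) = \sum_r (\sum_k a k * G k r) *: x r.
Proof.
under [RHS]eq_bigr => r _ do rewrite scaler_suml.
rewrite [RHS]exchange_big; apply: eq_bigr => k _; rewrite scaler_sumr.
by apply: eq_bigr => r _; rewrite scalerA.
Qed.

Lemma basis_unitmx (S : comUnitRingType) (M : lmodType S) n (v : 'I_n -> M)
    (U : 'M[S]_n) : U \in unitmx -> is_basis_of (fun _ => True) v ->
  is_basis_of (fun _ => True) (fun i => \sum_j U i j *: v j).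
Proof.
move=> Uu [_ vi vs].
have sumU (a : 'rV[S]_n) :
    \sum_i a 0 i *: \sum_j U i j *: v j = \sum_j (a *m U) 0 j *: v j.
  by rewrite (combination_sum v U); apply: eq_bigr => j _; rewrite mxE.
split=> // [a aE i|x _].
  have aU : (\row_k a k) *m U = 0.
    apply/rowP => j; rewrite [RHS]mxE; apply: (vi (fun j => (_ *m U) 0 j)).
    by rewrite -sumU -[RHS]aE; apply: eq_bigr => k _; rewrite mxE.
  have /rowP/(_ i) := congr1 (mulmx^~ (invmx U)) aU.
  by rewrite mulmxK // mul0mx !mxE.
have [b ->] := vs x I; exists (fun i => (\row_k b k *m invmx U) 0 i).
by rewrite sumU mulmxKV //; apply: eq_bigr => j _; rewrite mxE.
Qed.

Lemma basis_free_module (S : comNzRingType) (M : lmodType S) n (v : 'I_n -> M) :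
  is_basis_of (fun _ => True) v -> free_module M.
Proof.
move=> vB; have [c [cE cL cv]] := basis_coordinates vB.
pose h (g : {malg S['I_n]}) : M := \sum_i g@_i *: v i.
have hL : linear h.
  move=> s x y; rewrite /h scaler_sumr -big_split; apply: eq_bigr => i _.
  by rewrite mcoeffD mcoeffZ scalerDl scalerA.
pose h' : {linear {malg S['I_n]} -> M} :=
  HB.pack h (GRing.isLinear.Build _ _ _ _ _ hL).
pose hi x : {malg S['I_n]} := \sum_i << c x i *g i >>.
have hic x i : (hi x)@_i = c x i.
  rewrite /hi raddf_sum (bigD1 i) //= mcoeffUU big1 ?addr0 // => j ji.
  by rewrite mcoeffU (negPf ji).
exists 'I_n, h', hi => [g|x]; last first.
  by rewrite [RHS]cE; apply: eq_bigr => i _; rewrite hic.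
apply/malgP => i; rewrite hic; have [_ vi _] := vB.
by apply: (lin_indep_inj vi); rewrite -cE.
Qed.

Section Relations.
Variables (F : fieldType) (n : nat) (kap : 'I_n -> 'I_n -> 'I_n -> F).
Variables (T : comNzRingType) (tau : F -> T) (B : algType T) (x : 'I_n -> B).
Hypothesis xM : forall p q, x p * x q = \sum_r tau (kap p q r) *: x r.
Variables (G : 'I_n -> 'I_n -> T).
Local Notation w i := (\sum_p G i p *: x p).

Lemma combination_mul i j :
  w i * w j = \sum_r (\sum_p \sum_q G i p * G j q * tau (kap p q r)) *: x r.
Proof.
rewrite mulr_suml.
under [RHS]eq_bigr => r _ do rewrite scaler_suml.
rewrite [RHS]exchange_big; apply: eq_bigr => p _ /=.
under [RHS]eq_bigr => r _ do rewrite scaler_suml.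
rewrite [RHS]exchange_big mulr_sumr; apply: eq_bigr => q _ /=.
rewrite -!(scalerAl, scalerAr) scalerA xM scaler_sumr.
by apply: eq_bigr => r _; rewrite scalerA.
Qed.

End Relations.

Lemma det_lin_indep (S : idomainType) (M : lmodType S) n (x : 'I_n -> M)
    (h : 'M[S]_n) : lin_indep x -> \det h != 0 ->
  lin_indep (fun i => \sum_p h i p *: x p).
Proof.
move=> xi h0 a; rewrite (combination_sum x h) => E i.
have ah : \row_k a k *m h = 0.
  apply/rowP => r; rewrite [RHS]mxE; rewrite mxE -[RHS](xi _ E r).
  by apply: eq_bigr => k _; rewrite mxE.
have := congr1 (mulmx^~ (\adj h)) ah.
rewrite -mulmxA mul_mx_adj mul0mx mul_mx_scalar => /rowP/(_ i).
by rewrite !mxE => /eqP; rewrite mulf_eq0 (negPf h0) => /eqP.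
Qed.

(** The family [g] is as long as the basis [x], so independence makes the
    matrix invertible. *)
Lemma transition_matrix_det (K : fieldType) (P : lmodType K) n (x g : 'I_n -> P) :
  is_basis_of (fun _ => True) x -> lin_indep g ->
  exists2 G : 'M[K]_n, \det G != 0 & forall i, g i = \sum_p G i p *: x p.
Proof.
move=> [_ xi xs] gi.
have /choice[b bE] i : exists b : 'I_n -> K, g i = \sum_p b p *: x p by apply: xs.
pose G : 'M[K]_n := \matrix_(i, p) b i p.
have gE i : g i = \sum_p G i p *: x p.
  by rewrite bE; apply: eq_bigr => p _; rewrite mxE.
exists G => //; apply/det0P => -[v v0 vG].
case/eqP: v0; apply/rowP => i; rewrite [RHS]mxE; apply: (gi (v 0)).
rewrite (eq_bigr (fun i => v 0 i *: \sum_p G i p *: x p)) => [|k _]; last first.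
  by rewrite gE.
rewrite (combination_sum x G); apply: big1 => r _.
by have /rowP/(_ r) := vG; rewrite !mxE => ->; rewrite scale0r.
Qed.

(** * Bases and extension of scalars *)

Section BaseChangeBasis.
Variables (S : comNzRingType) (K : fieldType) (phi : {rmorphism S -> K}).
Variables (M : lmodType S) (n : nat) (v : 'I_n -> M).
Hypothesis v_basis : is_basis_of (fun _ => True) v.

(** The universal property is applied twice. Its existence part, for the map that
    takes the basis to the unit vectors of K^n, gives h from P to K^n and with it
    the independence. Its uniqueness part identifies with the identity the
    composite of h with the map K^n -> P given by the images of the basis, and
    so gives generation. *)
Lemma base_change_basis (P : lmodType K) (j : {linear M -> P | phi \; *:%R}) :
  is_base_change j -> is_basis_of (fun _ => True) (fun i => j (v i)).
Proof.
move=> jP.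
have [g gE] := basis_extension phi v_basis (fun i => delta_mx 0 i : 'rV[K]_n).
have [h [hj _]] := jP _ g.
have hv i : h (j (v i)) = delta_mx 0 i by rewrite hj gE.
split=> // [a /(congr1 h)|x _].
  rewrite raddf0 raddf_sum /= => E i.
  have /rowP/(_ i) := E; rewrite mxE summxE (bigD1 i) //= big1 ?addr0.
    by rewrite linearZ_LR hv !mxE !eqxx mulr1.
  by move=> k ki; rewrite linearZ_LR hv !mxE eq_sym (negPf ki) andbF mulr0.
pose k0 (y : 'rV[K]_n) := \sum_i y 0 i *: j (v i).
have k0L : linear (k0 \o h).
  move=> s x1 y; rewrite /k0 /= linearP scaler_sumr -big_split /=.
  by apply: eq_bigr => i _; rewrite !mxE scalerDl scalerA.
have [kh khE] : exists kh : {linear P -> P}, kh =1 k0 \o h.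
  pose kh' : {linear P -> P} :=
    HB.pack (k0 \o h) (GRing.isLinear.Build _ _ _ _ _ k0L).
  by exists kh'.
have [h1 [_ h1u]] := jP P j.
have khj y : kh (j y) = j y.
  have [_ _ /(_ y I) [a ->]] := v_basis.
  rewrite (semilinear_sum _ j) raddf_sum /=; apply: eq_bigr => i _.
  rewrite linearZ_LR khE /k0 /= hv (bigD1 i) //= mxE !eqxx scale1r big1 ?addr0 //.
  by move=> l /negPf li; rewrite mxE li andbF scale0r.
pose idP : {linear P -> P} := idfun.
exists (fun i => h x 0 i); rewrite -[RHS]/((k0 \o h) x) -khE (h1u kh khj).
by rewrite -(h1u idP).
Qed.

Lemma basis_base_change (P : lmodType K) (j : {linear M -> P | phi \; *:%R}) :
  is_basis_of (fun _ => True) (fun i => j (v i)) -> is_base_change j.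
Proof.
move=> jv Q g.
have [h hv] : exists h : {linear P -> Q}, forall i, h (j (v i)) = g (v i).
  exact: (basis_extension idfun jv (fun i => g (v i))).
exists h; split=> [x|h' h'j y].
  have [_ _ /(_ x I) [a ->]] := v_basis.
  rewrite !semilinear_sum raddf_sum /=; apply: eq_bigr => i _.
  by rewrite linearZ_LR hv.
have [_ _ /(_ y I) [a ->]] := jv; rewrite !raddf_sum /=; apply: eq_bigr => i _.
by rewrite !linearZ_LR hv h'j.
Qed.

End BaseChangeBasis.

(** * Bases of free modules over power series *)

Section FreeSeries.
Variables (F : fieldType) (M : lmodType (pseries F)).
Local Notation S := (pseries F).

Lemma free_module_torsion_free : free_module M ->
  forall x : M, pvar *: x = 0 -> x = 0.
Proof.
move=> [I [h [hi hK Kh]]] x; rewrite -(Kh x) -linearZ_LR => /(congr1 hi).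
rewrite hK -(raddf0 h) hK => /malgP E; congr (h _); apply/malgP => i.
have /eqP := E i; rewrite mcoeffZ mcoeff0 mulf_eq0 (negPf (pvar_neq0 _)).
by move/eqP.
Qed.

Lemma free_module_separated : free_module M ->
  forall x : M, (forall k, exists y, x = pvar ^+ k *: y) -> x = 0.
Proof.
move=> [I [h [hi hK Kh]]] x xdiv; rewrite -(Kh x) -(raddf0 h); congr (h _).
apply/malgP => i; rewrite mcoeff0; apply: pseriesP => k.
have [y ->] := xdiv k.+1; rewrite -(Kh y) -linearZ_LR hK mcoeffZ pcoef_varXM.
by rewrite ltnn.
Qed.

Variables (N : lmodType F) (n : nat) (e : 'I_n -> N) (d : 'I_n -> M).
Variable pi : {linear M -> N | @pcoef_at0 F \; *:%R}.
Hypothesis e_basis : is_basis_of (fun _ => True) e.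
Hypothesis pi_ker : forall x, pi x = 0 <-> exists y, x = pvar *: y.
Hypothesis pi_d : forall i, pi (d i) = e i.

(** A form of Nakayama's lemma. A relation between the lifts has all its
    coefficients divisible by t, and t can be cancelled, so that they vanish to
    every order. Conversely, subtracting from an element the combination of lifts
    with the same residue leaves t times another element; iterating determines
    all coefficients of the coordinates, and the error is divisible by every
    power of t. The free module [M] may a priori have infinite rank. *)
Lemma lift_basis : free_module M -> is_basis_of (fun _ => True) d.
Proof.
move=> Mfree; have [_ ei es] := e_basis.
have [c [cE _ _]] := basis_coordinates e_basis.
split=> // [a ad i|x _].
  have at0 (b : 'I_n -> S) : \sum_i b i *: d i = 0 -> forall i, b i 0%N = 0.
    move=> /(congr1 pi); rewrite raddf0 raddf_sum /= => E; apply: ei.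
    by rewrite -[RHS]E; apply: eq_bigr => l _; rewrite linearZ_LR /= pi_d.
  apply: pseriesP => k; rewrite pcoef0; elim: k a ad i => [|k IH] a ad i.
    exact: at0.
  have a0 l : a l = pvar * pshift 1 (a l).
    by rewrite {1}[a l]pseries_head (at0 a ad) rmorph0 add0r.
  have := IH (fun l => pshift 1 (a l)) _ i; rewrite /= addn1; apply.
  apply: (free_module_torsion_free Mfree); rewrite scaler_sumr -[RHS]ad.
  by apply: eq_bigr => l _; rewrite scalerA -a0.
have /choice[next nextP] y :
    exists z, y - \sum_i pconst (c (pi y) i) *: d i = pvar *: z.
  apply/pi_ker; rewrite raddfB raddf_sum /= {1}(cE (pi y)); apply/eqP.
  by rewrite subr_eq0; apply/eqP; apply: eq_bigr => i _; rewrite linearZ_LR /= pi_d.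
pose a (y : M) i : S := PSeries (fun k => c (pi (iter k next y)) i).
(* D is the error of the expansion, with D y = t D (next y). *)
pose D y := y - \sum_i a y i *: d i.
have DS y : D y = pvar *: D (next y).
  rewrite /D scalerBr -nextP -addrA; congr (_ + _).
  rewrite -opprD; congr (- _); rewrite scaler_sumr -big_split /=.
  apply: eq_bigr => i _; rewrite scalerA -scalerDl; congr (_ *: _).
  apply: pseriesP => -[|k]; rewrite pcoefD pcoef_varM /= ?addr0 // add0r.
  by rewrite -iterSr.
exists (a x); apply/eqP; rewrite -subr_eq0 -/(D x); apply/eqP.
apply: (free_module_separated Mfree) => k; exists (D (iter k next x)).
elim: k => [|k IH]; first by rewrite scale1r.
by rewrite IH DS scalerA exprSr.
Qed.

End FreeSeries.

(** A formal deformation of N has the unit of N as its unit, hence the lifted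
    basis must express the unit of [DD] with the same constant coordinates as
    the basis of N expresses the unit of N. An arbitrary lift misses this by an
    element eps of the kernel, which can be added to one lifted vector that
    occurs in the unit. *)
Lemma unit_adapted_lift (F : fieldType) (N : algType F) (DD : algType (pseries F))
    (pi : {lrmorphism DD -> N | @pcoef_at0 F \; *:%R}) n (e : 'I_n -> N)
    (c : 'I_n -> F) :
  (forall y, exists x, pi x = y) -> 1 = \sum_i c i *: e i ->
  exists d : 'I_n -> DD,
    (forall i, pi (d i) = e i) /\ 1 = \sum_i pconst (c i) *: d i.
Proof.
move=> pi_surj ce.
have [i0 ci0] : exists i, c i != 0.
  apply: contrapT => no; have /eqP := oner_neq0 N; apply; rewrite ce.
  apply: big1 => i _; suff -> : c i = 0 by rewrite scale0r.
  by apply/eqP; apply: contrapT => /negP ci; apply: no; exists i.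
have /choice[d' d'E] i : exists x, pi x = e i by apply: pi_surj.
pose eps := 1 - \sum_i pconst (c i) *: d' i.
have pi_eps : pi eps = 0.
  rewrite /eps raddfB raddf_sum /= rmorph1 ce; apply/eqP; rewrite subr_eq0.
  by apply/eqP; apply: eq_bigr => i _; rewrite linearZ_LR /= d'E.
exists (fun i => d' i + (if i == i0 then pconst (c i)^-1 else 0) *: eps).
split=> [i|].
  by rewrite raddfD /= linearZ_LR /= pi_eps scaler0 addr0.
rewrite (eq_bigr (fun i => pconst (c i) *: d' i +
    (if i == i0 then eps else 0))); last first.
  move=> i _; rewrite scalerDr scalerA; case: eqP => [->|_].
    by rewrite -rmorphM mulfV // rmorph1 scale1r.
  by rewrite mulr0 scale0r.
by rewrite big_split /= -big_mkcond /= big_pred1_eq /eps addrC subrK.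
Qed.

(** The rows of h span a submodule of the series vectors that contains
    t^e times everything, where e is the order of the determinant. Cutting off
    the terms of order more than e changes each row by t times an element of this
    submodule, thus by a matrix [U] that is the identity modulo t. *)
Lemma truncate_matrix (F : fieldType) n (h : 'M[pseries F]_n) : \det h != 0 ->
  exists2 U : 'M[pseries F]_n, U \in unitmx &
    exists e, forall i p k, (e <= k)%N -> ((U *m h) i p) k = 0.
Proof.
move=> h0; have [e [u [uu detE]]] := pseries_valuation h0.
pose r := map_mx (pshift e.+1) h.
pose U := 1%:M - (pvar * u^-1) *: (r *m \adj h).
have Uh : U *m h = h - pvar ^+ e.+1 *: r.
  rewrite mulmxBl mul1mx -scalemxAl -mulmxA mul_adj_mx detE mul_mx_scalar scalerA.
  by congr (_ - _ *: _); rewrite exprS mulrACA mulVr // mulr1.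
exists U.
  rewrite unitmxE; apply: pseries_unit.
  rewrite -[_ 0%N]/(pcoef_at0 _) -det_map_mx.
  rewrite (_ : map_mx _ U = 1%:M) ?det1 ?oner_neq0 //.
  apply/matrixP => i j; rewrite !mxE rmorphB rmorph_nat rmorphM.
  by rewrite [X in X * _](_ : _ = 0) ?mul0r ?subr0 //; exact: pcoef_varM.
exists e.+1 => i p k ek; rewrite Uh !mxE pcoefD pcoefN pcoef_varXM ek /=.
by rewrite subnK // subrr.
Qed.

(** * Power series with coefficients in an algebra *)

Lemma falgebra_basis (F : fieldType) (V : falgType F) n : \dim {:V} = n ->
  exists e : 'I_n -> V, is_basis_of (fun _ => True) e.
Proof.
move=> <-; exists (fun i => (vbasis {:V})`_i).
have vb := vbasisP {:V}; split=> // [a a0|x _].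
  by have /freeP vf := basis_free vb; apply: vf.
by exists (fun i => coord (vbasis {:V}) i x); rewrite -coord_vbasis // memvf.
Qed.

Section ConstantBasis.
Variables (F : fieldType) (V : algType F) (n : nat) (e : 'I_n -> V).
Local Notation S := (pseries F).
Local Notation E := (fun i => pconst (e i) : pseries V).

Lemma pconstZ c (x : V) : pconst (c *: x) = pconst c *: (pconst x : pseries V).
Proof.
apply: pseriesP => k; rewrite pcoefZ big_ord_recl /= subn0.
rewrite big1 ?addr0 => [|i _]; last by rewrite scale0r.
by case: k => //=; rewrite scaler0.
Qed.

Lemma pcoef_sumZ (a : 'I_n -> S) k :
  (\sum_i a i *: E i) k = \sum_i a i k *: e i.
Proof.
rewrite pcoef_sum; apply: eq_bigr => i _; rewrite pcoefZ big_ord_recr /= subnn.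
rewrite big1 ?add0r // => j _.
by rewrite subn_eq0 leqNgt ltn_ord scaler0.
Qed.

(** The coordinates of a series are found coefficient by coefficient. For an
    infinite basis the series of coordinates could be nonzero infinitely often. *)
Lemma pseries_basis : is_basis_of (fun _ => True) e ->
  is_basis_of (fun _ => True) E.
Proof.
move=> [_ ei es]; split=> // [a aE i|x _].
  apply: pseriesP => k; apply: (ei (fun i => a i k)).
  by rewrite -pcoef_sumZ aE.
have /choice[c cE] k : exists a : 'I_n -> F, x k = \sum_i a i *: e i by apply: es.
exists (fun i => PSeries (fun k => c k i)); apply: pseriesP => k.
by rewrite pcoef_sumZ.
Qed.

Lemma pvarZ (x : pseries V) k : (pvar *: x) k = if k is k'.+1 then x k' else 0.
Proof.
have -> : pvar *: x = pvar * x.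
  rewrite pscaleE; congr (_ * _); apply: pseriesP => -[|[|j]] //=;
  by rewrite ?scale0r ?scale1r.
exact: pcoef_varM.
Qed.

End ConstantBasis.

Lemma pvarXM (F : fieldType) (V : algType F) k (x : pseries V) :
  pvar ^+ k *: x = pvar ^+ k * x.
Proof.
elim: k x => [|k IH] x; first by rewrite scale1r mul1r.
rewrite !exprSr -scalerA IH -mulrA; congr (_ * _).
by apply: pseriesP => j; rewrite pvarZ pcoef_varM.
Qed.

Section SeriesAlgebra.
Variables (F : comNzRingType) (A : algType F).

Fact pseries_scaleAl (a : pseries F) (x y : pseries A) : a *: (x * y) = (a *: x) * y.
Proof. by rewrite !pscaleE mulrA. Qed.
Fact pseries_scaleAr (a : pseries F) (x y : pseries A) : a *: (x * y) = x * (a *: y).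
Proof. by rewrite !pscaleE mulrA plift_comm -mulrA plift_comm. Qed.
HB.instance Definition _ :=
  GRing.Lmodule_isLalgebra.Build (pseries F) (pseries A) pseries_scaleAl.
HB.instance Definition _ :=
  GRing.Lalgebra_isAlgebra.Build (pseries F) (pseries A) pseries_scaleAr.
End SeriesAlgebra.

(** * Formal deformations from structure constants *)

Section DeformationFromStructureConstants.
Variables (F : fieldType) (N : algType F) (n : nat) (e : 'I_n -> N).
Local Notation S := (pseries F).
Local Notation E := (fun i => pconst (e i) : pseries N).
Hypothesis e_basis : is_basis_of (fun _ => True) e.
Variables (a : 'I_n -> 'I_n -> 'I_n -> S) (u : 'I_n -> F).
Hypothesis eu : 1 = \sum_i u i *: e i.

Let E1 : pconst 1 = \sum_i pconst (u i) *: E i.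
Proof. by rewrite eu raddf_sum; apply: eq_bigr => i _; rewrite /= pconstZ. Qed.

(** Structure constants that come from an algebra [B] define a multiplication on
    N{t}: the linear map that takes the constant basis to [w] is injective and
    carries every axiom of [B] over to N{t}. *)
Lemma transported_multiplication (K : comNzRingType) (phi : {rmorphism S -> K})
    (B : algType K) (w : 'I_n -> B) : injective phi -> lin_indep w ->
    (forall i j, w i * w j = \sum_k phi (a i j k) *: w k) ->
    1 = \sum_i phi (pconst (u i)) *: w i ->
  exists m : formal_mul N, forall i j, fmul m (E i) (E j) = \sum_k a i j k *: E k.
Proof.
move=> phi_inj wi wa wu; have EB := pseries_basis e_basis.
have [c [cE cL cv]] := basis_coordinates EB.
have [L LE] := basis_extension phi EB w.
have L_inj : injective L.
  apply: (semilinear_inj EB) => //.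
  by move=> b; rewrite (eq_bigr (fun i => b i *: w i)) => [/wi|i _]; rewrite ?LE.
pose mul x y : pseries N :=
  \sum_i \sum_j (c x i * c y j) *: \sum_k a i j k *: E k.
have LM x y : L (mul x y) = L x * L y.
  rewrite {2}(cE x) {2}(cE y) !semilinear_sum mulr_suml raddf_sum.
  apply: eq_bigr => i _; rewrite mulr_sumr raddf_sum.
  apply: eq_bigr => j _ /=; rewrite linearZ_LR /= semilinear_sum rmorphM.
  rewrite -!(scalerAl, scalerAr) scalerA !LE wa; congr (_ *: _).
  by apply: eq_bigr => k _; rewrite LE.
have L1 : L (pconst 1) = 1.
  by rewrite E1 semilinear_sum wu; apply: eq_bigr => i _; rewrite LE.
have mulA : associative mul by move=> x y z; apply: L_inj; rewrite !LM mulrA.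
have mul1l : left_id (pconst 1) mul by move=> x; apply: L_inj; rewrite LM L1 mul1r.
have mul1r : right_id (pconst 1) mul by move=> x; apply: L_inj; rewrite LM L1 mulr1.
have mulDl : left_distributive mul +%R.
  by move=> x y z; apply: L_inj; rewrite raddfD /= !LM raddfD mulrDl.
have mulDr : right_distributive mul +%R.
  by move=> x y z; apply: L_inj; rewrite raddfD /= !LM raddfD mulrDr.
have mulZl s x y : mul (s *: x) y = s *: mul x y.
  by apply: L_inj; rewrite LM !linearZ_LR LM /= scalerAl.
have mulZr s x y : mul x (s *: y) = s *: mul x y.
  by apply: L_inj; rewrite LM !linearZ_LR LM /= scalerAr.
exists (FormalMul mulA mul1l mul1r mulDl mulDr mulZl mulZr) => i j /=.
apply: L_inj; rewrite LM semilinear_sum !LE wa.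
by apply: eq_bigr => k _; rewrite LE.
Qed.

Variable m : formal_mul N.
Hypothesis ma : forall i j, fmul m (E i) (E j) = \sum_k a i j k *: E k.

Lemma deformed_basis : is_basis_of (M := deformed m) (fun _ => True) E.
Proof. exact: (pseries_basis e_basis). Qed.

Lemma deformed_morphism (K : comNzRingType) (phi : {rmorphism S -> K})
    (B : algType K) (w : 'I_n -> B) :
    (forall i j, w i * w j = \sum_k phi (a i j k) *: w k) ->
    1 = \sum_i phi (pconst (u i)) *: w i ->
  exists g : {lrmorphism deformed m -> B | phi \; *:%R}, forall i, g (E i) = w i.
Proof.
move=> wa wu.
exact: (basis_algebra_extension deformed_basis ma wa E1 wu).
Qed.

Hypothesis ea : forall i j, e i * e j = \sum_k a i j k 0%N *: e k.

(** The reduction modulo t is the evaluation of series at 0. It is an algebra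
    morphism since the structure constants reduce to those of N. *)
Lemma deformed_is_formal_deformation : is_formal_deformation m.
Proof.
have [pi piE] := @deformed_morphism F (@pcoef_at0 F) N e ea eu.
have pi0 (x : deformed m) : pi x = (x : pseries N) 0%N.
  have [_ _ /(_ x I) [b ->]] := deformed_basis.
  rewrite semilinear_sum [RHS]pcoef_sumZ.
  by apply: eq_bigr => i _; congr (_ *: _); apply: piE.
exists pi; split=> [y|x].
  by exists (pconst y : pseries N); rewrite pi0.
rewrite pi0; split=> [x0|[y ->]]; last by rewrite pvarZ.
exists (pshift 1 x); apply: pseriesP => -[|k]; rewrite pvarZ //=.
by rewrite addn1.
Qed.

End DeformationFromStructureConstants.

(** * Subalgebras of Laurent series obtained by the method *)

Section FreeAlgebra.
Variables (F : fieldType) (n : nat) (B : algType (pseries F)) (b : 'I_n -> B).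

(** A word goes to the product of the images of its letters. *)
Lemma free_algebra_morphism :
  exists f : {lrmorphism free_alg F n -> B}, forall i, f (free_gen F i) = b i.
Proof.
pose h (w : {fmonom 'I_n}) : B := \prod_(i <- (w : seq 'I_n)) b i.
have hM : mmorphism h.
  by split=> [x y|]; rewrite /h ?fmM ?big_cat // fm1 big_nil.
have [h' hE] : exists h' : {mmorphism {fmonom 'I_n} -> B}, h' =1 h.
  pose h' : {mmorphism {fmonom 'I_n} -> B} :=
    HB.pack h (isMultiplicative.Build _ _ h hM).
  by exists h'.
pose f := mmap (GRing.in_alg B) h'.
have fM : multiplicative f.
  apply: commr_mmap_is_multiplicative => g k w.
  by rewrite /= /GRing.comm -scalerAl -scalerAr mul1r mulr1.
have fL : linear f.
  by move=> s x y; rewrite /f raddfD /= mmapZ /= -scalerAl mul1r.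
pose f' : {lrmorphism free_alg F n -> B} :=
  HB.pack f (GRing.isLinear.Build _ _ _ _ f fL)
    (GRing.isMultiplicative.Build _ _ f fM).
exists f' => i; rewrite /= /f /free_gen mmapU /= scale1r mul1r.
by rewrite hE /h fmU big_seq1.
Qed.
End FreeAlgebra.

Section LaurentMaps.
Variables (F : fieldType) (A : algType F) (M : nat).

Lemma lmake0 : lmake M 0 = 0 :> laurent A.
Proof. by apply: (addrI (lmake M 0)); rewrite -lmakeD !addr0. Qed.

Lemma lmake_sumZ n (a : 'I_n -> pseries F) (p : 'I_n -> pseries A) :
  lmake M (\sum_i a i *: p i) = \sum_i a i *: lmake M (p i).
Proof.
rewrite (big_morph _ (@lmakeD A M) lmake0); apply: eq_bigr => i _.
exact: (esym (lmakeZ _ _ _)).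
Qed.

Lemma lmake_pole (p : pseries A) : pole_le M (lmake M p).
Proof. by move=> k; rewrite /= /lmake_coef -subr_lt0 opprK; case: (k + _). Qed.

Lemma lmake_laurent_poly (p : pseries A) e :
  (forall k, (e <= k)%N -> p k = 0) -> laurent_poly (lmake M p).
Proof.
move=> pe; exists e => k ek; rewrite /= /lmake_coef.
case E : (k + _) => [l|//]; apply: pe; lia.
Qed.

End LaurentMaps.

(** An algebra [DD] embedded in the Laurent series over [A] is obtained by the
    method as soon as it has full rank. Truncation of its basis in the sense of
    [truncate_matrix] gives another basis, made of Laurent polynomials; the
    generators of the free algebra are sent to this basis, so that the image is
    all of [DD] and the generators serve both as the elements [c] and as the
    elements [q] of the method. The bound on the poles holds because [DD] is
    finitely generated as a module. *)
Lemma realized_by_method (F : fieldType) (A : algType F) n (al : 'I_n -> A)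
    (DD : algType (pseries F)) (v : 'I_n -> DD)
    (l : {lrmorphism DD -> laurent A}) M (h : 'M[pseries F]_n) :
    is_basis_of (fun _ => True) al -> is_basis_of (fun _ => True) v ->
    \det h != 0 ->
    (forall i, l (v i) = lmake M (\sum_p h i p *: (pconst (al p) : pseries A))) ->
  obtained_by_method A n DD.
Proof.
move=> alB vB h0 lv; pose x p : pseries A := pconst (al p).
have [U Uu [e Ue]] := truncate_matrix h0.
pose d i := \sum_j U i j *: v j.
have dB : is_basis_of (fun _ => True) d := basis_unitmx Uu vB.
have ld i : l (d i) = lmake M (\sum_p (U *m h) i p *: x p).
  rewrite /d raddf_sum.
  rewrite (eq_bigr (fun j => U i j *: lmake M (\sum_p h j p *: x p))); last first.
    by move=> j _; rewrite /= linearZ_LR /= lv.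
  rewrite -lmake_sumZ (combination_sum x h (fun j => U i j)); congr lmake.
  by apply: eq_bigr => p _; rewrite mxE.
have UhI : \det (U *m h) != 0.
  rewrite det_mulmx mulf_neq0 //; apply: contraTneq Uu => U0.
  by rewrite unitmxE U0 unitr0.
have ldI : lin_indep (fun i => l (d i)).
  move=> b; under eq_bigr => i _ do rewrite ld.
  have [_ xI _] := pseries_basis alB.
  move=> E; apply: (det_lin_indep xI UhI).
  by apply: (@lmake_inj _ M); rewrite lmake_sumZ E lmake0.
have [f' f'E] := free_algebra_morphism d.
pose f : {lrmorphism free_alg F n -> laurent A} := l \o f'.
have fE i : f (free_gen F i) = l (d i) by rewrite /= f'E.
have genC (i : 'I_n) : const_coefs (free_gen F i).
  by move=> w; exists (fmu i == w)%:R; rewrite mcoeffU rmorph_nat.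
have [_ dI ds] := dB.
exists n, f; split.
  split.
  - move=> i; rewrite fE ld; apply: (@lmake_laurent_poly _ _ _ _ e) => k ek.
    rewrite pcoef_sumZ big1 // => p _.
    by rewrite Ue // scale0r.
  - exists (@free_gen F n); split=> //.
    by move=> b; rewrite (eq_bigr (fun i => b i *: l (d i))) => [/ldI|i _]; rewrite ?fE.
  - exists M => p; rewrite /f /=.
    have [_ _ /(_ (f' p) I) [b ->]] := vB.
    rewrite raddf_sum.
    rewrite (eq_bigr (fun i => b i *: lmake M (\sum_p h i p *: x p))); last first.
      by move=> i _; rewrite /= linearZ_LR /= lv.
    by rewrite -lmake_sumZ; apply: lmake_pole.
have /choice[s sE] (km : 'I_n * 'I_n) : exists a : 'I_n -> pseries F,
    d km.1 * d km.2 = \sum_i a i *: d i by apply: ds.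
exists (@free_gen F n), (fun i k m => s (k, m) i 0%N),
  (fun i k m => pshift 1 (s (k, m) i)), d.
have dM k m : d k * d m =
    \sum_i (pconst (s (k, m) i 0%N) + pvar * pshift 1 (s (k, m) i)) *: d i.
  by rewrite (sE (k, m)); apply: eq_bigr => i _; rewrite -pseries_head.
split=> //.
- move=> i w; have [c ->] := genC i w; exists c%:P => k.
  by rewrite coefC.
- split=> [i|b|g [p <-]]; first by exists (free_gen F i).
    by rewrite (eq_bigr (fun i => b i *: l (d i))) => [/ldI|i _]; rewrite ?fE.
  have [b bE] := ds (f' p) I; exists b; rewrite /f /= bE raddf_sum.
  by apply: eq_bigr => i _; rewrite /= linearZ_LR f'E.
- move=> k m; rewrite !fE -rmorphM dM raddf_sum; apply: eq_bigr => i _.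
  by rewrite /= linearZ_LR f'E.
Qed.

(** * Structure constants over the algebraic closure and over power series *)

Section StructureTransfer.
Variables (F : closedFieldType) (K : closedFieldType).
Hypothesis charF : [pchar F] =i pred0.
Local Notation S := (pseries F).
Variable iota : {rmorphism {fraction S} -> K}.
Hypothesis algK : is_algebraic_closure iota.
Local Notation phi := (iota \o @tofrac S).
Variables (n : nat) (kap : 'I_n -> 'I_n -> 'I_n -> F) (c u : 'I_n -> F).
Variables (a : 'I_n -> 'I_n -> 'I_n -> S) (G : 'M[K]_n).
Hypothesis G0 : \det G != 0.
Hypothesis GM : forall i j r,
  \sum_p \sum_q G i p * G j q * phi (pconst (kap p q r)) =
  \sum_k phi (a i j k) * G k r.
Hypothesis G1 : forall p, \sum_i phi (pconst (c i)) * G i p = phi (pconst (u p)).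

(** The matrix [G] describes an isomorphism between an algebra with structure
    constants [a] and an algebra with constant structure constants [kap], over
    the algebraic closure of the Laurent series; [c] and [u] are the coordinates
    of the units. Being an isomorphism is a condition on the entries of [G] made
    of polynomial equations and one inequation, so it is inherited by a matrix
    over the Laurent series, at the price of t := t^m in [a]. The power of t is
    the denominator of that matrix. *)
Lemma structure_transfer : exists m M (h : 'M[S]_n),
  [/\ (0 < m)%N, \det h != 0,
      forall i j r, \sum_p \sum_q h i p * h j q * pconst (kap p q r) =
        pvar ^+ M * \sum_k psubst m (a i j k) * h k r
    & forall p, \sum_i pconst (c i) * h i p = pvar ^+ M * pconst (u p)].
Proof.
have [m [ev1 [ev2 [q [m0 ev1C ev2C qE ker]]]]] :=
  puiseux_specialization charF algK (fun ij : 'I_n * 'I_n => G ij.1 ij.2).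
pose Q : 'M[{poly {fraction S}}]_n := \matrix_(i, j) q (i, j).
pose H := map_mx ev2 Q.
have Q1 : map_mx ev1 Q = G by apply/matrixP => i j; rewrite /Q !mxE qE.
have Qij i j : ev1 (Q i j) = G i j by rewrite -Q1 [RHS]mxE.
have Hij i j : ev2 (Q i j) = H i j by rewrite [RHS]mxE.
pose C (s : S) : {poly {fraction S}} := (tofrac s)%:P.
have C1 s : ev1 (C s) = phi s by rewrite ev1C.
have C2 s : ev2 (C s) = tofrac (psubst m s) by rewrite ev2C.
have kerP p1 p2 : ev1 p1 = ev1 p2 -> ev2 p1 = ev2 p2.
  by move=> E; apply/eqP; rewrite -subr_eq0 -rmorphB -ker rmorphB E subrr.
have H0 : \det H != 0 by rewrite det_map_mx -ker -det_map_mx Q1.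
have evX (L : comNzRingType) (ev : {rmorphism {poly {fraction S}} -> L}) i j r :
    ev (\sum_p \sum_q Q i p * Q j q * C (pconst (kap p q r))) =
    \sum_p \sum_q ev (Q i p) * ev (Q j q) * ev (C (pconst (kap p q r))).
  rewrite rmorph_sum; apply: eq_bigr => p _; rewrite rmorph_sum.
  by apply: eq_bigr => l _; rewrite !rmorphM.
have evY (L : comNzRingType) (ev : {rmorphism {poly {fraction S}} -> L})
    (s : 'I_n -> S) p :
    ev (\sum_k C (s k) * Q k p) = \sum_k ev (C (s k)) * ev (Q k p).
  by rewrite rmorph_sum; apply: eq_bigr => k _; rewrite rmorphM.
have HM i j r : \sum_p \sum_q H i p * H j q * tofrac (pconst (kap p q r)) =
    \sum_k tofrac (psubst m (a i j k)) * H k r.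
  have /kerP : ev1 (\sum_p \sum_q Q i p * Q j q * C (pconst (kap p q r))) =
      ev1 (\sum_k C (a i j k) * Q k r).
    rewrite evX evY; under [RHS]eq_bigr => k _ do rewrite C1 Qij.
    by rewrite -GM; apply: eq_bigr => p _; apply: eq_bigr => l _; rewrite C1 !Qij.
  rewrite evX evY; under [RHS]eq_bigr => k _ do rewrite C2 Hij.
  move=> <-; apply: eq_bigr => p _; apply: eq_bigr => l _.
  by rewrite C2 psubst_const // !Hij.
have H1 p : \sum_i tofrac (pconst (c i)) * H i p = tofrac (pconst (u p)).
  have /kerP : ev1 (\sum_i C (pconst (c i)) * Q i p) = ev1 (C (pconst (u p))).
    by rewrite evY C1 -G1; apply: eq_bigr => i _; rewrite C1 Qij.
  rewrite C2 psubst_const // => <-; rewrite evY.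
  by apply: eq_bigr => i _; rewrite C2 psubst_const // Hij.
have [M [h hE]] := uniform_denominator H.
have injF : injective (@tofrac S) by move=> x y /eqP; rewrite tofrac_eq => /eqP.
have tM0 : tofrac (pvar ^+ M : S) != 0 by rewrite tofrac_eq0 expf_neq0 ?pvar_neq0.
exists m, M, h; split=> //.
- rewrite -(tofrac_eq0 (\det h)) -det_map_mx.
  have -> : map_mx (@tofrac S) h = tofrac (pvar ^+ M) *: H.
    by apply/matrixP => i j; rewrite mxE hE [RHS]mxE.
  rewrite detZ; exact: (mulf_neq0 (expf_neq0 n tM0) H0).
- move=> i j r; apply: injF; rewrite rmorphM !rmorph_sum.
  have -> : \sum_k tofrac (psubst m (a i j k) * h k r) =
      tofrac (pvar ^+ M) * \sum_k tofrac (psubst m (a i j k)) * H k r.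
    rewrite mulr_sumr; apply: eq_bigr => k _.
    by rewrite rmorphM /= hE mulrCA.
  rewrite -HM mulrA mulr_sumr; apply: eq_bigr => p _.
  rewrite rmorph_sum mulr_sumr; apply: eq_bigr => l _.
  by rewrite !rmorphM /= !hE mulrACA !mulrA.
- move=> p; apply: injF; rewrite rmorphM /= -H1 rmorph_sum mulr_sumr.
  by apply: eq_bigr => i _; rewrite rmorphM /= hE mulrCA.
Qed.

End StructureTransfer.

(** * The theorem *)

Section FlatDeformation.
Variables (F : closedFieldType).
Hypothesis charF : [pchar F] =i pred0.
Local Notation S := (pseries F).
Variables (n : nat) (N A : falgType F).
Hypothesis dimN : \dim {:N} = n.
Hypothesis dimA : \dim {:A} = n.
Variables (K : closedFieldType) (iota : {rmorphism {fraction S} -> K}).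
Hypothesis algK : is_algebraic_closure iota.
Local Notation phi := (iota \o @tofrac S).

(** The substitution t := t^m turns [DD] into another deformation of N, whose
    structure constants have the same constant terms. It carries the embedding
    into the Laurent series over A and the isomorphism over the algebraic
    closure that [structure_transfer] provides. *)
Theorem flat_deformation_by_method :
  (exists DD : algType S, is_flat_deformation iota N A DD) ->
  exists m : formal_mul N,
    [/\ is_formal_deformation m,
        is_flat_deformation iota N A (deformed m)
      & obtained_by_method A n (deformed m)].
Proof.
case=> DD [[DDfree [pi [pi_surj pi_ker]]]].
case=> P1 [P2 [j1 [j2 [bc1 bc2 [h12 h12bij]]]]].
have [e eB] := falgebra_basis dimN; have [al alB] := falgebra_basis dimA.
have [_ _ es] := eB; have [_ _ als] := alB.
have [c cE] := es 1 I; have [u uE] := als 1 I.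
have [d [pid dE]] := unit_adapted_lift pi_surj cE.
have dB := lift_basis eB pi_ker pid DDfree; have [_ _ ds] := dB.
have /choice[a0 a0E] (ij : 'I_n * 'I_n) : exists a : 'I_n -> S,
    d ij.1 * d ij.2 = \sum_k a k *: d k by apply: ds.
pose a i j k := a0 (i, j) k.
have aE i j : d i * d j = \sum_k a i j k *: d k by rewrite (a0E (i, j)).
have /choice[k0 k0E] (pq : 'I_n * 'I_n) : exists a : 'I_n -> F,
    al pq.1 * al pq.2 = \sum_r a r *: al r by apply: als.
pose kap p q r := k0 (p, q) r.
have kapE p q : al p * al q = \sum_r kap p q r *: al r by rewrite (k0E (p, q)).
have eM i j : e i * e j = \sum_k a i j k 0%N *: e k.
  have := congr1 pi (aE i j); rewrite (semilinear_sum d pi) rmorphM /= !pid => ->.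
  by apply: eq_bigr => k _; rewrite pid.
(* The images of the two bases in A (x) K, and the matrix G between them. *)
pose x p := j2 (al p).
have xB : is_basis_of (fun _ => True) x := base_change_basis alB bc2.
have xM p q : x p * x q = \sum_r phi (pconst (kap p q r)) *: x r.
  by have := congr1 j2 (kapE p q); rewrite (semilinear_sum al j2) rmorphM.
have x1 : 1 = \sum_p phi (pconst (u p)) *: x p.
  by have := congr1 j2 uE; rewrite (semilinear_sum al j2) rmorph1.
pose g i := h12 (j1 (d i)).
have gI : lin_indep g.
  have [_ j1dI _] := base_change_basis dB bc1.
  move=> b bg; apply: j1dI; apply: (bij_inj h12bij); rewrite raddf0 -bg raddf_sum.
  by apply: eq_bigr => i _; rewrite /= linearZ_LR.
have gM i j : g i * g j = \sum_k phi (a i j k) *: g k.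
  have := congr1 (h12 \o j1) (aE i j); rewrite /= !rmorphM => ->.
  rewrite (semilinear_sum d j1) raddf_sum.
  by apply: eq_bigr => k _; rewrite /= linearZ_LR.
have g1 : 1 = \sum_i phi (pconst (c i)) *: g i.
  have := congr1 (h12 \o j1) dE; rewrite /= !rmorph1 => ->.
  rewrite (semilinear_sum d j1) raddf_sum.
  by apply: eq_bigr => k _; rewrite /= linearZ_LR.
have [G G0 gG] := transition_matrix_det xB gI.
have [_ xI _] := xB.
have GM i j r : \sum_p \sum_q G i p * G j q * phi (pconst (kap p q r)) =
    \sum_k phi (a i j k) * G k r.
  apply: (lin_indep_inj
    (a := fun r => \sum_p \sum_q G i p * G j q * phi (pconst (kap p q r)))
    (b := fun r => \sum_k phi (a i j k) * G k r) xI _ r).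
  rewrite -(combination_mul xM) -!gG gM -(combination_sum x G).
  by apply: eq_bigr => k _; rewrite gG.
have G1 p : \sum_i phi (pconst (c i)) * G i p = phi (pconst (u p)).
  apply: (lin_indep_inj (a := fun p => \sum_i phi (pconst (c i)) * G i p)
    (b := fun p => phi (pconst (u p))) xI _ p).
  rewrite -x1 -(combination_sum x G) g1.
  by apply: eq_bigr => k _; rewrite gG.
have [m [M [h [m0 h0 hM h1]]]] := structure_transfer charF algK G0 GM G1.
pose a' i j k := psubst m (a i j k).
have phi_inj : injective phi.
  by move=> s t /= /fmorph_inj/eqP; rewrite tofrac_eq => /eqP.
have tM0 : phi (pvar ^+ M) != 0.
  by rewrite -(rmorph0 phi) (inj_eq phi_inj) expf_neq0 ?pvar_neq0.
(* The matrix h / t^M now plays over K the role that G had. *)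
pose H := map_mx phi h.
have H0 : \det H != 0 by rewrite det_map_mx -(rmorph0 phi) (inj_eq phi_inj).
pose W i := \sum_p H i p *: x p.
have WM i j : W i * W j = phi (pvar ^+ M) *: \sum_k phi (a' i j k) *: W k.
  rewrite (combination_mul xM) (combination_sum x H) scaler_sumr.
  apply: eq_bigr => r _; rewrite scalerA; congr (_ *: _).
  transitivity (phi (\sum_p \sum_q h i p * h j q * pconst (kap p q r))).
    rewrite rmorph_sum; apply: eq_bigr => p _; rewrite rmorph_sum.
    by apply: eq_bigr => q _; rewrite !rmorphM !mxE.
  rewrite hM rmorphM rmorph_sum; congr (_ * _); apply: eq_bigr => k _.
  by rewrite rmorphM mxE.
have W1 : \sum_i phi (pconst (c i)) *: W i = phi (pvar ^+ M) *: 1.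
  rewrite (combination_sum x H) x1 scaler_sumr; apply: eq_bigr => p _.
  rewrite scalerA -rmorphM -h1 rmorph_sum; congr (_ *: _).
  by apply: eq_bigr => i _; rewrite rmorphM mxE.
pose w i := (phi (pvar ^+ M))^-1 *: W i.
have wM i j : w i * w j = \sum_k phi (a' i j k) *: w k.
  rewrite -scalerAl -scalerAr WM [X in _ *: X]scalerA mulVf // scale1r.
  rewrite scaler_sumr; apply: eq_bigr => k _.
  by rewrite !scalerA mulrC.
have w1 : 1 = \sum_i phi (pconst (c i)) *: w i.
  transitivity ((phi (pvar ^+ M))^-1 *: \sum_i phi (pconst (c i)) *: W i).
    by rewrite W1 scalerA mulVf // scale1r.
  by rewrite scaler_sumr; apply: eq_bigr => i _; rewrite !scalerA mulrC.
have HU : (phi (pvar ^+ M))^-1 *: H \in unitmx.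
  by rewrite unitmxE unitfE detZ mulf_neq0 // expf_neq0 // invr_eq0.
have wB : is_basis_of (fun _ => True) w.
  have -> : w = (fun i => \sum_p ((phi (pvar ^+ M))^-1 *: H) i p *: x p).
    apply/funext => i; rewrite /w /W scaler_sumr; apply: eq_bigr => p _.
    by rewrite scalerA [in RHS]mxE.
  exact: basis_unitmx.
have [_ wI _] := wB.
have [mu muE] := transported_multiplication eB cE phi_inj wI wM w1.
have eM' i j : e i * e j = \sum_k a' i j k 0%N *: e k.
  by rewrite eM; apply: eq_bigr => k _; rewrite psubst_at0.
have muF := deformed_is_formal_deformation eB cE muE eM'.
have muB := deformed_basis eB mu.
have [j jE] := deformed_morphism eB cE muE wM w1.
(* The matrix h also gives the subalgebra of the Laurent series over A spanned
   by the elements t^(-M) v_i, with the same structure constants. *)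
pose y p : pseries A := pconst (al p).
have yM p q : y p * y q = \sum_r pconst (kap p q r) *: y r.
  by rewrite /y -rmorphM kapE raddf_sum; apply: eq_bigr => r _; rewrite /= pconstZ.
have y1 : 1 = \sum_p pconst (u p) *: y p.
  rewrite -[1](rmorph1 (@pconst A)) uE raddf_sum.
  by apply: eq_bigr => r _; rewrite /= pconstZ.
pose v i := \sum_p h i p *: y p.
have vM i j' : v i * v j' = pvar ^+ M * \sum_k a' i j' k *: v k.
  rewrite (combination_mul yM) (combination_sum y h) -pvarXM scaler_sumr.
  by apply: eq_bigr => r _; rewrite scalerA hM.
have v1 : \sum_i pconst (c i) *: v i = pvar ^+ M * 1.
  rewrite (combination_sum y h) -pvarXM y1 scaler_sumr; apply: eq_bigr => p _.
  by rewrite scalerA -h1.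
have lM i j' : lmake M (v i) * lmake M (v j') = \sum_k a' i j' k *: lmake M (v k).
  by rewrite [LHS]lmakeM vM lmake_var lmake_sumZ.
have l1 : 1 = \sum_i pconst (c i) *: lmake M (v i).
  by rewrite -lmake_sumZ v1 -[M in lmake M]addn0 lmake_var.
(* A morphism that is semilinear along the identity is linear. *)
have [l lE] : exists l : {lrmorphism deformed mu -> laurent A},
    forall i, l (pconst (e i) : pseries N) = lmake M (v i).
  exact: (deformed_morphism (phi := idfun) eB cE muE lM l1).
exists mu; split=> //.
- split; first by split=> //; apply: (basis_free_module muB).
  exists P2, P2, j, j2; split=> //; last by exists idfun; exists idfun.
  apply: (basis_base_change muB).
  by have -> : (fun i => j (pconst (e i) : pseries N)) = w by apply/funext.
- exact: (realized_by_method alB muB h0 lE).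
Qed.

End FlatDeformation.

Theorem theorem25 (R : realType) (n : nat) (N A : falgType R[i])
    (dimN : \dim {:N} = n) (dimA : \dim {:A} = n)
    (K : closedFieldType) (iota : {rmorphism {fraction pseries R[i]} -> K})
    (algK : is_algebraic_closure iota) :
  (exists DD : algType (pseries R[i]), is_flat_deformation iota N A DD) ->
  exists m : formal_mul N,
    [/\ is_formal_deformation m,
        is_flat_deformation iota N A (deformed m)
      & obtained_by_method A n (deformed m)].
Proof.
by apply: flat_deformation_by_method => //; apply: pchar_num.
Qed.
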